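(* Let $\beta\in\mathcal{BD}_g([0,T];\mathbb{F})$ be $g$-regressive, i.e. $1+\beta(t)\Delta g(t)\neq0$ for all $t\in[0,T]\cap D_g$. The solutions in $\mathcal{BD}^1_g([0,T];\mathbb{F})$ of the problem $$v'_g(t)-\beta(t)v(t)=0\ \text{ for } g\text{-a.e. } t\in[0,T),\qquad v(0)=1,$$ are exactly the functions of the form $h\cdot v$, where $h\in\ker(\partial_g)$ with $h(0)=1$ and $v\in W^{1,1}_g([0,T];\mathbb{F})\cap\mathcal{BD}^1_g([0,T];\mathbb{F})$ is the unique $g$-absolutely continuous solution of the problem.
   Context: Let $T>0$, $\mathbb{F}$ be $\mathbb{R}$ or $\mathbb{C}$, and let $g:\mathbb{R}\to\mathbb{R}$ be non-decreasing and left-continuous (a ''derivator''). Put $\Delta g(t)=g(t^+)-g(t)$, $D_g=\{t\in\mathbb{R}:\Delta g(t)>0\}$, and $C_g=\{t\in\mathbb{R}: g \text{ is constant on } (t-\varepsilon,t+\varepsilon)\text{ for some }\varepsilon>0\}$. The set $C_g$ is open; write $C_g=\bigcup_n (a_n,b_n)$ with $(a_n,b_n)$ its (pairwise disjoint) connected components. Put $N_g^-=\{a_n\}_n\setminus D_g$, $N_g^+=\{b_n\}_n\setminus D_g$, $N_g=N_g^-\cup N_g^+$. Standing assumption: $0\notin N_g^-$ and $T\notin N_g^+\cup D_g\cup C_g$. $g$-derivative: for $f:[0,T]\to\mathbb{F}$ and $t\in[0,T]$, $f'_g(t)=\lim_{s\to t}\frac{f(s)-f(t)}{g(s)-g(t)}$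 if $t\notin D_g\cup C_g$; $f'_g(t)=\lim_{s\to t^+}\frac{f(s)-f(t)}{g(s)-g(t)}$ if $t\in D_g$; $f'_g(t)=\lim_{s\to b_n^+}\frac{f(s)-f(b_n)}{g(s)-g(b_n)}$ if $t\in(a_n,b_n)\subset C_g$; provided the limit exists. Limits are taken over those $s\in[0,T]$ for which the denominator is nonzero. $f$ is $g$-continuous at $t\in[0,T]$ if for every $\varepsilon>0$ there is $\delta>0$ with $|f(t)-f(s)|<\varepsilon$ for all $s\in[0,T]$ with $|g(t)-g(s)|<\delta$. It is left (resp. right) $g$-continuous at $t$ if for every $\varepsilon>0$ there is $\delta>0$ such that $|f(s)-f(t)|<\varepsilon$ for all $s\in[0,T]$ with $s<t$ and $g(t)-g(s)<\delta$ (resp. $s>t$ and $g(s)-g(t)<\delta$). $\mathcal{BD}_g([0,T];\mathbb{F})$ is the set of bounded $f:[0,T]\to\mathbb{F}$ that are $g$-continuous at every point of $[0,T]\setminus(C_g\cup N_g\cup D_g)$, left $g$-continuous on $N_g^-\cap[0,T]$ and right $g$-continuous on $N_g^+\cap[0,T]$. $\mathcal{BD}^1_g([0,T];\mathbb{F})$ is the set of $f\in\mathcal{BD}_g([0,T];\mathbb{F})$ such that $f'_g(t)$ exists for all $t\in[0,T]$ and $f'_g\in\mathcal{BD}_g([0,T];\mathbb{F})$. $\ker(\partial_g)=\{h\in\mathcal{BD}^1_g([0,T];\mathbb{F}): h'_g(t)=0\ \forall t\in[0,T]\}$. $\mu_g$ is the Lebesgue–Stieltjes measure with $\mu_g([c,d))=g(d)-g(c)$;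 ''$g$-a.e.'' means $\mu_g$-a.e. $W^{1,1}_g([0,T];\mathbb{F})$ is the set of $g$-absolutely continuous functions $F:[0,T]\to\mathbb{F}$: for every $\varepsilon>0$ there is $\delta>0$ such that for every finite family of pairwise disjoint open subintervals $(c_j,d_j)$ of $[0,T]$, $\sum_j(g(d_j)-g(c_j))<\delta$ implies $\sum_j|F(d_j)-F(c_j)|<\varepsilon$ (equivalently, $F(x)=F(0)+\int_{[0,x)}F'_g\,d\mu_g$ with $F'_g$ existing $g$-a.e. and $\mu_g$-integrable). *)

(* Defs.v *)
From HB Require Import structures.
From mathcomp Require Import all_boot all_order all_algebra.
From mathcomp Require Import complex.
From mathcomp Require Import all_classical all_reals all_analysis.

Set Implicit Arguments.
Unset Strict Implicit.
Unset Printing Implicit Defensive.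
Import Order.TTheory GRing.Theory Num.Theory.
Import numFieldNormedType.Exports.
Local Open Scope classical_set_scope.
Local Open Scope ring_scope.

Inductive scalars := Reals | Complexes.

Definition scalar_field (R : realType) (F : scalars) : numFieldType :=
  match F with Reals => R | Complexes => R[i]%C end.

Definition of_real (R : realType) (F : scalars) : R -> scalar_field R F :=
  match F with Reals => fun x => x | Complexes => fun x => x%:C%C end.
Arguments of_real {R} F x.

Record derivator (R : realType) := Derivator {
  derivator_fun :> R -> R ;
  derivator_nd : {homo derivator_fun : x y / x <= y} ;
  derivator_lc : forall x, derivator_fun @ x^'- --> derivator_fun x }.

Section measure_of_derivator.
Context {R : realType}.
Implicit Type g : derivator R.

(* The library builds Lebesgue-Stieltjes measures from right-continuous
   functions, with value f b - f a on ]a, b]; the measure of a left-continuous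
   function is obtained from it by the reflection x |-> - x. *)
Definition reflect_derivator g (x : R) : R := - g (- x).

Lemma reflect_derivator_nd g : {homo reflect_derivator g : x y / x <= y}.
Proof. by move=> x y xy; rewrite lerN2 derivator_nd// lerN2. Qed.

Lemma reflect_derivator_rc g : right_continuous (reflect_derivator g).
Proof.
move=> x; apply: cvgN; apply/cvg_at_rightNP.
rewrite (_ : _ \o _ = g); first exact: derivator_lc.
by apply/funext => y /=; rewrite opprK.
Qed.

HB.instance Definition _ g := isCumulative.Build R _ R (reflect_derivator g)
  (@reflect_derivator_nd g) (@reflect_derivator_rc g).

Definition mu_g g : set (measurableTypeR R) -> \bar R :=
  pushforward (lebesgue_stieltjes_measure (reflect_derivator g))
    (-%R : measurableTypeR R -> measurableTypeR R).

Let mu_g0 g : mu_g g set0 = 0%E.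
Proof. by rewrite /mu_g measure0. Qed.

Let mu_g_ge0 g A : (0 <= mu_g g A)%E.
Proof. exact: measure_ge0. Qed.

Let mu_g_sigma_additive g : semi_sigma_additive (mu_g g).
Proof. by apply: measure_semi_sigma_additive. Qed.

HB.instance Definition _ g := isMeasure.Build _ _ _ (mu_g g)
  (mu_g0 g) (mu_g_ge0 g) (@mu_g_sigma_additive g).

Lemma mu_g_itv g (c d : R) : c <= d -> mu_g g `[c, d[%classic = (g d - g c)%:E.
Proof.
move=> cd; rewrite /mu_g /pushforward opp_preimage_itvbndbnd/=.
rewrite /lebesgue_stieltjes_measure /measure_extension/= measurable_mu_extE/=.
  rewrite wlength_itv_bnd ?lerN2//.
  by rewrite /reflect_derivator/= !opprK addrC.
exact: is_ocitv.
Qed.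

End measure_of_derivator.

Section derivator_sets.
Context {R : realType}.
Variable g : derivator R.

Definition jump (t : R) : R := lim (g @ t^'+) - g t.

Definition Dg : set R := [set t | 0 < jump t].

Definition Cg : set R :=
  [set t | exists2 e, 0 < e & forall s, t - e < s < t + e -> g s = g t].

(* ]a, b[ is a connected component of Cg; components may be unbounded. *)
Definition Cg_component (a b : \bar R) : Prop :=
  exists2 t, Cg t &
    connected_component Cg t = [set s | (a < s%:E)%E /\ (s%:E < b)%E].

Definition Ngm : set R := [set a | exists b, Cg_component a%:E b] `\` Dg.

Definition Ngp : set R := [set b | exists a, Cg_component a b%:E] `\` Dg.

Definition Ng : set R := Ngm `|` Ngp.

End derivator_sets.

(* Functions on [0, T] are represented by total functions on R, whose values
   outside [0, T] none of the notions below depends on. Norms, hence the e's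
   bounding them, live in K; in R[i], 0 < e says that e is a positive real. *)
Section derivator_functions.
Context {R : realType} {F : scalars}.
Variables (g : derivator R) (T : R).
Local Notation K := (scalar_field R F).
Implicit Types (f h : R -> K) (t s : R).

Definition gquot f t s : K := (f s - f t) / of_real F (g s - g t).

Definition gadm t : set R := [set s | 0 <= s <= T /\ g s != g t].

Definition is_gderive f t (l : K) : Prop :=
  [\/ ~ (Dg g `|` Cg g) t /\ gquot f t @ within (gadm t) (nbhs t) --> l,
      Dg g t /\ gquot f t @ within (gadm t) t^'+ --> l
    | exists a b, [/\ Cg_component g a b%:E, (a < t%:E)%E, t < b
                    & gquot f b @ within (gadm b) b^'+ --> l]].

Definition gderivable f t : Prop := exists l, is_gderive f t l.

Definition gderive f t : K := xget 0 [set l | is_gderive f t l].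

Definition gcontinuous_at f t : Prop :=
  forall e : K, 0 < e -> exists2 d : R, 0 < d &
    forall s, 0 <= s <= T -> `|g t - g s| < d -> `|f t - f s| < e.

Definition left_gcontinuous_at f t : Prop :=
  forall e : K, 0 < e -> exists2 d : R, 0 < d &
    forall s, 0 <= s <= T -> s < t -> g t - g s < d -> `|f s - f t| < e.

Definition right_gcontinuous_at f t : Prop :=
  forall e : K, 0 < e -> exists2 d : R, 0 < d &
    forall s, 0 <= s <= T -> t < s -> g s - g t < d -> `|f s - f t| < e.

Definition BD f : Prop :=
  [/\ [bounded f t | t in `[0, T]%classic],
      forall t, 0 <= t <= T -> ~ (Cg g `|` Ng g `|` Dg g) t ->
        gcontinuous_at f t,
      forall t, 0 <= t <= T -> Ngm g t -> left_gcontinuous_at f t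
    & forall t, 0 <= t <= T -> Ngp g t -> right_gcontinuous_at f t].

Definition BD1 f : Prop :=
  [/\ BD f, forall t, 0 <= t <= T -> gderivable f t & BD (gderive f)].

Definition ker_gderive h : Prop :=
  BD1 h /\ forall t, 0 <= t <= T -> gderive h t = 0.

Definition W11 f : Prop :=
  forall e : K, 0 < e -> exists2 d : R, 0 < d &
    forall (n : nat) (a b : 'I_n -> R),
      (forall j, [/\ 0 <= a j, a j < b j & b j <= T]) ->
      trivIset setT (fun j => `]a j, b j[%classic) ->
      \sum_(j < n) (g (b j) - g (a j)) < d ->
      \sum_(j < n) `|f (b j) - f (a j)| < e.

Definition gregressive (beta : R -> K) : Prop :=
  forall t, 0 <= t <= T -> Dg g t -> 1 + beta t * of_real F (jump g t) != 0.

Definition solution (beta w : R -> K) : Prop :=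
  {ae mu_g g, forall t, 0 <= t < T ->
    gderivable w t /\ gderive w t - beta t * w t = 0} /\ w 0 = 1.

End derivator_functions.

(* Main.v *)
Require Import Defs.
From HB Require Import structures.
From mathcomp Require Import all_boot all_order all_algebra.
From mathcomp Require Import complex.
From mathcomp Require Import all_classical all_reals all_analysis.
From mathcomp Require Import ring lra.

Set Implicit Arguments.
Unset Strict Implicit.
Unset Printing Implicit Defensive.
Import Order.TTheory GRing.Theory Num.Theory.
Import numFieldNormedType.Exports.
Local Open Scope classical_set_scope.
Local Open Scope ring_scope.

(** Why the theorem is true.

    The exceptional sets of the definitions are bookkeeping. At a point of [Cg]
    the derivative is computed at the right endpoint [star t] of the component
    of [t]; at a point [t] outside [Cg] it is the limit of [gquot f t] along one
    filter, [gfilter t] ([is_gderiveP]). A bounded function is in BD when, at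
    every point outside [Cg] and [Dg], it is continuous in the ordinary sense
    from each side on which [g] increases strictly ([BDP]). The assumptions on
    [0] and [T] ensure that at least one of these sides lies in [[0, T]].

    A [g]-Lipschitz solution exists for every coefficient in BD, regressive or
    not ([exponential_exists]). It is a limit of Euler polygons over finer and
    finer finite sets of nodes, obtained by compactness; no integral is needed,
    since the polygons satisfy the estimates that express the equation
    [v' = beta v] at every point outside [Cg], and these pass to the limit.

    The solution [v] is inverted by solving another equation. Let [z] be the
    exponential of the adjoint coefficient
    [gamma = - beta / (1 + beta Delta g)], which is defined and again in BD
    because [beta] is regressive ([BD_adjoint]). The product rule of the
    [g]-derivative ([rderM]) has the additional term [f' h' Delta g], hence
    [u' = beta u] gives [(u z)' = u z (beta + gamma + beta gamma Delta g) = 0].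
    An absolutely continuous function with zero derivative almost everywhere is
    constant ([W11_constant]). So [u z = 1] for every absolutely continuous
    solution [u]; in particular [v z = 1], and [u = v].

    A solution [w] in BD1 need not be absolutely continuous, and [w z] need not
    be constant. But [w' - beta w] is in BD and vanishes almost everywhere,
    hence at every point outside [Cg] ([BD_ae_eq0]); so [h = w z] has zero
    derivative everywhere, and [w = h v]. Conversely, if [h' = 0] then the
    product rule gives [(h v)' = h v' = beta h v]. *)

(** * The scalars and their real-valued norm *)

Section scalars.
Context {R : realType} {F : scalars}.
Local Notation K := (scalar_field R F).
Implicit Types (x y : K) (a b : R).

Fact of_real_is_zmod_morphism : zmod_morphism (of_real F : R -> K).
Proof. by case: F => // a b /=; rewrite rmorphB. Qed.

Fact of_real_is_monoid_morphism : monoid_morphism (of_real F : R -> K).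
Proof. by case: F; split => // a b /=; rewrite rmorphM. Qed.

HB.instance Definition _ := GRing.isZmodMorphism.Build R K (of_real F)
  of_real_is_zmod_morphism.
HB.instance Definition _ := GRing.isMonoidMorphism.Build R K (of_real F)
  of_real_is_monoid_morphism.

Lemma ler_of_real a b : (of_real F a <= of_real F b) = (a <= b).
Proof. by case: F => //=; rewrite lecR. Qed.

Lemma ltr_of_real a b : (of_real F a < of_real F b) = (a < b).
Proof. by case: F => //=; rewrite ltcR. Qed.

Lemma of_real_inj : injective (of_real F : R -> K).
Proof. exact: fmorph_inj. Qed.

(** The order of [K] is partial when [K] is [R[i]]; with a norm in [R] the
    estimates are the same for both fields, and accessible to [lra]. *)
Definition rnorm : K -> R :=
  match F return scalar_field R F -> R with
  | Reals => fun z : R => `|z|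
  | Complexes => fun z => complex.Re (`|z| : R[i])
  end.

Lemma normE x : `|x| = of_real F (rnorm x).
Proof.
by move: x; rewrite /rnorm; case: F => //= x; rewrite RRe_real// normr_real.
Qed.

Lemma rnorm_ge0 x : 0 <= rnorm x.
Proof. by rewrite -ler_of_real rmorph0 -normE. Qed.

Lemma rnormD x y : rnorm (x + y) <= rnorm x + rnorm y.
Proof. by have := ler_normD x y; rewrite !normE -rmorphD ler_of_real. Qed.

Lemma rnormM x y : rnorm (x * y) = rnorm x * rnorm y.
Proof. by apply: of_real_inj; have := normrM x y; rewrite !normE -rmorphM. Qed.

Lemma rnormN x : rnorm (- x) = rnorm x.
Proof. by apply: of_real_inj; rewrite -!normE normrN. Qed.

Lemma rnormB x y : rnorm (x - y) <= rnorm x + rnorm y.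
Proof. by rewrite -(rnormN y) rnormD. Qed.

Lemma rnorm_distC x y : rnorm (x - y) = rnorm (y - x).
Proof. by rewrite -rnormN opprB. Qed.

Lemma rnorm_dist_tri z x y : rnorm (x - y) <= rnorm (x - z) + rnorm (z - y).
Proof. by rewrite -[x - y](subrKA z) rnormD. Qed.

Lemma rnorm0 : rnorm 0 = 0.
Proof. by apply: of_real_inj; rewrite -normE normr0 rmorph0. Qed.

Lemma rnorm1 : rnorm 1 = 1.
Proof. by apply: of_real_inj; rewrite -normE normr1 rmorph1. Qed.

Lemma rnormV x : rnorm x^-1 = (rnorm x)^-1.
Proof. by apply: of_real_inj; have := normfV x; rewrite !normE -fmorphV. Qed.

Lemma rnorm_eq0 x : (rnorm x == 0) = (x == 0).
Proof. by rewrite -(inj_eq of_real_inj) -normE rmorph0 normr_eq0. Qed.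

Lemma rnorm_of_real a : rnorm (of_real F a) = `|a|.
Proof.
have Hp b : 0 <= b -> rnorm (of_real F b) = b.
  move=> b0; apply: of_real_inj.
  by rewrite -normE ger0_norm// -(rmorph0 (of_real F)) ler_of_real.
have [a0|/ltW a0] := leP 0 a; first by rewrite ger0_norm// Hp.
by rewrite ler0_norm// -rnormN -rmorphN Hp// oppr_ge0.
Qed.

Lemma pos_of_realP (e : K) : 0 < e -> exists2 d : R, 0 < d & e = of_real F d.
Proof.
move=> e0; have eE : e = of_real F (rnorm e) by rewrite -normE gtr0_norm.
by exists (rnorm e) => //; rewrite -ltr_of_real -eE rmorph0.
Qed.

Lemma pos_of_real a : 0 < a -> 0 < of_real F a.
Proof. by rewrite -ltr_of_real rmorph0. Qed.

Lemma cvg_rnormP T (G : set_system T) {FG : Filter G} (f : T -> K) (l : K) :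
  f @ G --> l <->
  forall e : R, 0 < e -> \forall t \near G, rnorm (f t - l) < e.
Proof.
split=> [/cvgrPdist_lt fl e e0|fl].
  have := fl _ (pos_of_real e0); apply: filterS => t.
  by rewrite normE ltr_of_real rnorm_distC.
apply/cvgrPdist_lt => e /pos_of_realP[d d0 ->].
by have := fl _ d0; apply: filterS => t; rewrite normE ltr_of_real rnorm_distC.
Qed.

Lemma cvg_of_real T (G : set_system T) {FG : Filter G} (f : T -> R) (l : R) :
  f @ G --> l -> of_real F (f t) @[t --> G] --> of_real F l.
Proof.
move=> /cvgrPdist_lt fl; apply/cvg_rnormP => e /fl; apply: filterS => t.
by rewrite -rmorphB rnorm_of_real distrC.
Qed.

Lemma cvg_rnorm_le T (G : set_system T) {FG : ProperFilter G} (f : T -> K) l c :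
  f @ G --> l -> (\forall t \near G, rnorm (f t) <= c) -> rnorm l <= c.
Proof.
move=> /cvg_rnormP fl fc; apply/ler_addgt0Pr => e /fl fle.
have [t [ft1 ft2]] := filter_ex (filterI fle fc).
have := rnormD (l - f t) (f t); rewrite subrK rnorm_distC => /le_trans; apply.
by rewrite addrC lerD// ltW.
Qed.

End scalars.

Lemma ultra_cvg_bounded_real (R : realType) T (G : set_system T)
    {UG : UltraFilter G} (f : T -> R) (M : R) :
  (forall t, `|f t| <= M) -> exists l : R, f @ G --> l.
Proof.
move=> fM.
have [|l [_ fl]] := @segment_compact R (- M) M (f @ G) (fmap_proper_filter f _).
  apply: (@filterE _ G) => t; rewrite /mkset/= in_itv/= -ler_norml.
  exact: fM.
(* a cluster point of the image of an ultrafilter is its limit *)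
exists l => V Vl; have [//|GV] := in_ultra_setVsetC (f @^-1` V) UG.
have [y [yV Vy]] := fl (~` V) V GV Vl.
by [].
Qed.

Lemma ultra_cvg_bounded (R : realType) (F : scalars) T (G : set_system T)
    {UG : UltraFilter G} (f : T -> scalar_field R F) (M : R) :
  (forall t, rnorm (f t) <= M) -> exists l : scalar_field R F, f @ G --> l.
Proof.
have normi : `|'i%C| = 1 :> R[i].
  by rewrite normc_def/= expr0n expr1n add0r sqrtr1.
case: F f => f fM.
  have [l fl] := ultra_cvg_bounded_real fM; exists l.
  by apply/cvg_rnormP => e e0; exact: (cvgr_distC_lt _ _ fl).
have leRe (z : R[i]) : `|complex.Re z| <= complex.Re `|z|.
  by rewrite -lecR RRe_real ?normr_real// normc_ge_Re.
have leIm (z : R[i]) : `|complex.Im z| <= complex.Re `|z|.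
  by have := leRe (z * 'i%C); rewrite ReiNIm normrN normrM normi mulr1.
have normr_complex (a : R) : `|a%:C%C| = `|a|%:C%C :> R[i].
  by rewrite normc_def/= expr0n addr0 sqrtr_sqr.
have le_ReIm (y z : R[i]) : @rnorm R Complexes (y - z) <=
    `|complex.Re y - complex.Re z| + `|complex.Im y - complex.Im z|.
  rewrite -(@ler_of_real R Complexes) -normE rmorphD/=.
  have -> : y - z = (complex.Re y - complex.Re z)%:C%C +
                    'i%C * (complex.Im y - complex.Im z)%:C%C.
    rewrite !rmorphB mulrBr addrACA -opprD -!complexE.
    by [].
  by rewrite (le_trans (ler_normD _ _))// normrM normi mul1r !normr_complex.
have fRI t : `|complex.Re (f t)| <= M /\ `|complex.Im (f t)| <= M.
  by split; [apply: le_trans (leRe _) (fM t)|apply: le_trans (leIm _) (fM t)].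
have [a fa] := ultra_cvg_bounded_real (fun t => (fRI t).1).
have [b fb] := ultra_cvg_bounded_real (fun t => (fRI t).2).
exists (Complex a b); apply/cvg_rnormP => e e0.
have e2 : 0 < e / 2 by rewrite divr_gt0.
move/cvgr_distC_lt : fa => /(_ _ e2) fa.
move/cvgr_distC_lt : fb => /(_ _ e2) fb.
apply: filterS2 fa fb => t ta tb.
by apply: le_lt_trans (le_ReIm (f t) (Complex a b)) _ => /=; lra.
Qed.

(** * Non-decreasing left-continuous functions *)

(** The finite-partition form of the compactness of a segment. A point [x]
    need only be handled by subintervals that reach beyond it on the right:
    this is what makes the lemma applicable at a jump of the derivator, whose
    jump is seen by [g v - g x] for [x < v] but not by [g x - g u]. *)
Lemma local_to_global (R : realType) (P : R -> R -> Prop) (a b : R) :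
  a <= b ->
  (forall x, P x x) ->
  (forall x y z, a <= x -> x <= y -> y <= z -> z <= b ->
     P x y -> P y z -> P x z) ->
  (forall x, a <= x <= b -> exists2 d, 0 < d & forall u v,
     a <= u -> u <= x -> x <= v -> v <= b -> x - d < u -> v < x + d ->
     x < v \/ x = b -> P u v) ->
  P a b.
Proof.
move=> ab P0 Ptrans Ploc.
pose A := [set t | a <= t <= b /\ P a t].
have Aa : A a by split; rewrite ?lexx ?ab.
have supA : has_sup A by split; [exists a|exists b => t [/andP[]]].
have as_ : a <= sup A by apply: ub_le_sup => //; exact: supA.2.
have sb : sup A <= b by apply: ge_sup; [exists a|move=> t [/andP[]]].
have [|d d0 Pd] := Ploc (sup A); first by rewrite as_.
have [u Au su] := sup_adherent d0 supA.
have us : u <= sup A by apply: ub_le_sup => //; exact: supA.2.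
have {Au} [/andP[au ub] Pau] := Au.
have {}Pd v : sup A <= v -> v <= b -> v < sup A + d -> sup A < v \/ sup A = b ->
    P a v.
  move=> sv vb vd svb.
  by apply: (Ptrans a u v) => //; [exact: le_trans us sv|exact: Pd].
have [sltb|bs] := ltP (sup A) b; last first.
  have sE : sup A = b by apply/le_anti; rewrite sb.
  by apply: Pd; rewrite ?sE ?ltrDl//; right.
pose v := Num.min b (sup A + d / 2).
have sv : sup A < v by rewrite /v lt_min sltb ltrDl divr_gt0.
have vb : v <= b by rewrite /v ge_min lexx.
have Pav : P a v.
  apply: Pd; rewrite ?(ltW sv)//; last by left.
  by rewrite /v gt_min ltrD2l ltr_pdivrMr// ltr_pMr// ltr1n orbT.
have : v <= sup A.
  apply: ub_le_sup; [exact: supA.2|split => //].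
  by rewrite vb (le_trans as_)// ltW.
by rewrite leNgt sv.
Qed.

Section derivators.
Context {R : realType}.
Variable g : derivator R.
Implicit Types (s t u v x y : R).

Definition left_increasing t := forall s, s < t -> g s < g t.
Definition right_increasing t := forall s, t < s -> g t < g s.

Lemma derivator_left t e : 0 < e ->
  exists2 d, 0 < d & forall s, t - d < s -> s <= t -> g t - g s < e.
Proof.
move=> e0; have /cvgrPdist_lt/(_ _ e0)[d /= d0 dP] := @derivator_lc R g t.
exists d => // s ds.
rewrite le_eqVlt => /predU1P[->|st]; first by rewrite subrr.
apply: le_lt_trans (ler_norm _) _; apply: dP => //=.
by rewrite ltr_distlC; lra.
Qed.

Lemma derivator_right_cvg t : g @ t^'+ --> lim (g @ t^'+).
Proof.
apply: nondecreasing_at_right_is_cvgr.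
  by near=> x => y z _ _; exact: derivator_nd.
near=> x; exists (g t) => _ /= [y + <-]; rewrite in_itv/= => /andP[/ltW ty _].
exact: derivator_nd.
Unshelve. all: by end_near. Qed.

Lemma derivator_right t e : 0 < e ->
  exists2 d, 0 < d & forall s, t < s -> s < t + d -> g s - g t < jump g t + e.
Proof.
move=> e0.
have /cvgrPdist_lt/(_ _ e0)[d /= d0 dP] := derivator_right_cvg (t:=t).
exists d => // s ts sd.
have : `|lim (g @ t^'+) - g s| < e by apply: dP => //=; rewrite ltr_distlC; lra.
by rewrite distrC ltr_distl /jump => /andP[]; lra.
Qed.

Lemma jump_le t s : t < s -> jump g t <= g s - g t.
Proof.
move=> ts; rewrite lerD2r; apply: limr_le.
  exact: derivator_right_cvg.
near=> x; apply: derivator_nd; near: x; exact: nbhs_right_le.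
Unshelve. all: by end_near. Qed.

Lemma jump_ge0 t : 0 <= jump g t.
Proof.
rewrite subr_ge0; apply: limr_ge.
  exact: derivator_right_cvg.
near=> x; apply: derivator_nd; near: x; exact: nbhs_right_ge.
Unshelve. all: by end_near. Qed.

Lemma jump_eq0 t : ~ Dg g t -> jump g t = 0.
Proof.
by move=> /negP; rewrite /Dg/= -leNgt => h; apply/le_anti; rewrite h jump_ge0.
Qed.

Lemma Dg_right_increasing t : Dg g t -> right_increasing t.
Proof. by move=> /lt_le_trans Dt s /jump_le /Dt; rewrite subr_gt0. Qed.

Lemma Cg_flat s t u : s < t -> t < u -> g s = g u -> Cg g t.
Proof.
move=> st tu su; exists (Num.min (t - s) (u - t)).
  by rewrite lt_min !subr_gt0 st tu.
move=> x; set e := Num.min _ _ => xt.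
have [e1 e2] : e <= t - s /\ e <= u - t by rewrite !ge_min !lexx orbT.
have h y : s <= y -> y <= u -> g y = g s.
  by move=> sy yu; apply/le_anti; rewrite {1}su !derivator_nd.
by rewrite !h//; lra.
Qed.

Lemma not_Cg_increasing t : ~ Cg g t -> left_increasing t \/ right_increasing t.
Proof.
move=> Ct; apply: contrapT => /not_orP[].
move=> /existsNP[s /not_implyP[st /negP]]; rewrite -leNgt => gst.
move=> /existsNP[u /not_implyP[tu /negP]]; rewrite -leNgt => gut.
apply: Ct; apply: (Cg_flat st tu); apply/le_anti.
by rewrite derivator_nd ?(le_trans gut)// (le_trans (ltW st))// ltW.
Qed.

Lemma Cg_not_right_increasing t : Cg g t -> ~ right_increasing t.
Proof.
move=> [e e0 te] /(_ (t + e / 2)); rewrite ltrDl divr_gt0// => /(_ isT).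
by rewrite te ?ltxx//; lra.
Qed.

Lemma Cg_not_Dg t : Cg g t -> ~ Dg g t.
Proof. by move=> /Cg_not_right_increasing + /Dg_right_increasing. Qed.

Lemma Cg_nbhd t : Cg g t ->
  exists2 e, 0 < e & forall s, t - e < s < t + e -> Cg g s.
Proof.
move=> [e e0 te]; exists e => // s /andP[es se].
apply: (@Cg_flat ((t - e + s) / 2) s ((t + e + s) / 2)); try lra.
by rewrite !te//; lra.
Qed.

Lemma Cg_cst x y : x <= y -> (forall s, x <= s <= y -> Cg g s) -> g x = g y.
Proof.
move=> xy Cxy; apply: (@local_to_global R (fun u v => g u = g v)) => //.
  by move=> ? ? ? _ _ _ _ ->.
move=> s /Cxy[e e0 se]; exists e => // u v _ us sv _ eu ve _.
by rewrite !se//; lra.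
Qed.

Lemma sub_Cg_component x y : x <= y -> (forall s, x <= s <= y -> Cg g s) ->
  connected_component (Cg g) x y.
Proof.
move=> xy Cxy; have := @connected_component_max _ (Cg g) `[x, y]%classic x.
apply.
- by rewrite /= in_itv/= lexx xy.
- by move=> s; rewrite /= in_itv/=; exact: Cxy.
- by apply/connected_intervalP; exact: interval_is_interval.
- by rewrite /= in_itv/= xy lexx.
Qed.

(** The endpoints are the extended infimum and supremum of the component,
    which does not contain them since [Cg] is open. *)
Lemma component_exists t : Cg g t ->
  exists a b, [/\ Cg_component g a b, (a < t%:E)%E & (t%:E < b)%E].
Proof.
move=> Ct; pose I := connected_component (Cg g) t.
have It : I t by exact: connected_component_refl.
have intI : is_interval I.
  by apply/connected_intervalP; exact: component_connected.
have openI s : I s -> exists2 e, 0 < e & I (s - e) /\ I (s + e).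
  move=> Is; have [e e0 se] := Cg_nbhd (@connected_component_sub _ _ _ _ Is).
  have e2 : 0 < e / 2 by rewrite divr_gt0.
  exists (e / 2) => //; split; apply: (connected_component_trans Is).
    apply: connected_component_sym; apply: sub_Cg_component; first lra.
    by move=> x xs; apply: se; lra.
  by apply: sub_Cg_component; [lra|move=> x xs; apply: se; lra].
pose a := ereal_inf (EFin @` I); pose b := ereal_sup (EFin @` I).
have Iab s : I s -> (a < s%:E)%E /\ (s%:E < b)%E.
  move=> /openI[e e0 [Ise Ies]]; split.
    apply: (@le_lt_trans _ _ (s - e)%:E); last by rewrite lte_fin; lra.
    by apply: ereal_inf_lbound; exists (s - e).
  apply: (@lt_le_trans _ _ (s + e)%:E); first by rewrite lte_fin; lra.
  by apply: ereal_sup_ubound; exists (s + e).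
exists a, b; split; try by case: (Iab _ It).
exists t => //; apply/seteqP; split => // s [/ereal_inf_lt[_ [x Ix <-]]].
rewrite lte_fin => xs /ereal_sup_gt[_ [y Iy <-]]; rewrite lte_fin => sy.
by apply: (intI _ _ Ix Iy); rewrite !ltW.
Qed.

Section component.
Variables a b : \bar R.
Hypothesis ab : Cg_component g a b.

Lemma component_sub s : (a < s%:E)%E -> (s%:E < b)%E -> Cg g s.
Proof.
case: ab => t Ct tab as_ sb; apply: (@connected_component_sub _ (Cg g) t).
by rewrite tab.
Qed.

Lemma component_nonempty : exists t, (a < t%:E)%E /\ (t%:E < b)%E.
Proof.
case: ab => t Ct tab; exists t.
suff : [set s | (a < s%:E)%E /\ (s%:E < b)%E] t by [].
by rewrite -tab; exact: connected_component_refl.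
Qed.

Lemma component_left_endpoint c : a = c%:E -> ~ Cg g c.
Proof.
case: ab => t Ct tab ac Cc; have [e e0 ce] := Cg_nbhd Cc.
have [ct tb] : (a < t%:E)%E /\ (t%:E < b)%E.
  suff : [set s | (a < s%:E)%E /\ (s%:E < b)%E] t by [].
  by rewrite -tab; exact: connected_component_refl.
have : connected_component (Cg g) t c.
  apply: connected_component_sym; apply: sub_Cg_component.
    by move: ct; rewrite ac lte_fin => /ltW.
  move=> s /andP[cs st]; have [sc|sc] := ltP s (c + e); first by apply: ce; lra.
  apply: component_sub; first by rewrite ac lte_fin; lra.
  by apply: le_lt_trans tb; rewrite lee_fin.
by rewrite tab/= ac ltxx => -[].
Qed.

Lemma component_right_endpoint c : b = c%:E -> ~ Cg g c.
Proof.
case: ab => t Ct tab bc Cc; have [e e0 ce] := Cg_nbhd Cc.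
have [at_ tc] : (a < t%:E)%E /\ (t%:E < b)%E.
  suff : [set s | (a < s%:E)%E /\ (s%:E < b)%E] t by [].
  by rewrite -tab; exact: connected_component_refl.
have : connected_component (Cg g) t c.
  apply: sub_Cg_component.
    by move: tc; rewrite bc lte_fin => /ltW.
  move=> s /andP[ts sc]; have [cs|cs] := ltP (c - e) s; first by apply: ce; lra.
  apply: component_sub; last by rewrite bc lte_fin; lra.
  by apply: lt_le_trans at_ _; rewrite lee_fin.
by rewrite tab/= bc ltxx => -[].
Qed.

End component.
End derivators.

(** * Where a left-continuous function increases *)

Section endpoints.
Context {R : realType}.
Variable g : derivator R.
Implicit Types (s t : R).

(** Left continuity extends the constancy of [g] to the right endpoint. *)
Lemma component_flat (a : \bar R) (b s : R) :
  Cg_component g a b%:E -> (a < s%:E)%E -> s <= b -> g s = g b.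
Proof.
move=> ab as_; rewrite le_eqVlt => /predU1P[->//|sb].
apply/le_anti; rewrite derivator_nd ?(ltW sb)//= leNgt; apply/negP => gsb.
rewrite -subr_gt0 in gsb; have [d d0 dP] := derivator_left g b gsb.
pose x := Num.max s (b - d / 2).
have [sx xb dx] : [/\ s <= x, x < b & b - d < x].
  by rewrite /x le_max lexx gt_max sb lt_max; split => //; lra.
have := dP _ dx (ltW xb); rewrite -(@Cg_cst _ g s x)// ?ltxx//.
move=> y /andP[sy yx]; apply: (component_sub ab).
  by apply: lt_le_trans as_ _; rewrite lee_fin.
by rewrite lte_fin (le_lt_trans yx).
Qed.

Lemma Ngm_not_Cg t : Ngm g t -> ~ Cg g t.
Proof. by case=> -[b /component_left_endpoint] + _; apply. Qed.

Lemma Ngp_not_Cg t : Ngp g t -> ~ Cg g t.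
Proof. by case=> -[a /component_right_endpoint] + _; apply. Qed.

Lemma Ngm_not_right_increasing t : Ngm g t -> ~ right_increasing g t.
Proof.
case=> -[b tb] /jump_eq0 t0 rt; have [s [ts sb]] := component_nonempty tb.
rewrite lte_fin in ts.
have gts : 0 < g s - g t by rewrite subr_gt0 rt.
have [d d0 dP] := derivator_right g t gts.
pose x := Num.min s (t + d / 2).
have [xs tx xd] : [/\ x <= s, t < x & x < t + d].
  by rewrite /x ge_min lexx lt_min ts gt_min; split => //; lra.
have := dP _ tx xd; rewrite t0 add0r (@Cg_cst _ g x s)// ?ltxx//.
move=> y /andP[xy ys]; apply: (component_sub tb).
  by rewrite lte_fin (lt_le_trans tx).
by apply: le_lt_trans sb; rewrite lee_fin.
Qed.

Lemma Ngp_not_left_increasing t : Ngp g t -> ~ left_increasing g t.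
Proof.
case=> -[a at_] _ lt; have [s [as_ st]] := component_nonempty at_.
rewrite lte_fin in st; have := lt _ st.
by rewrite (component_flat at_) ?ltxx// ltW.
Qed.

Lemma Ngm_of_flat t : ~ Cg g t -> ~ right_increasing g t -> Ngm g t.
Proof.
move=> Ct rt; split; last by move=> /Dg_right_increasing.
move: rt => /existsNP[u /not_implyP[tu /negP]]; rewrite -leNgt => gut.
have gE : g t = g u by apply/le_anti; rewrite gut derivator_nd ?ltW.
have Cm s : t < s -> s < u -> Cg g s by move=> ts su; exact: (Cg_flat ts su).
have Cmid : Cg g ((t + u) / 2) by apply: Cm; lra.
have [a [b [ab am mb]]] := component_exists Cmid.
exists b; suff <- : a = t%:E by [].
apply/le_anti/andP; split; rewrite leNgt; apply/negP => h.
  case: a ab am h => [a|//|//] ab; rewrite !lte_fin => am ta.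
  by apply: (component_left_endpoint ab erefl); apply: Cm => //; lra.
apply: Ct; apply: (component_sub ab h); apply: le_lt_trans mb.
by rewrite lee_fin; lra.
Qed.

Lemma Ngp_of_flat t : ~ Cg g t -> ~ Dg g t -> ~ left_increasing g t -> Ngp g t.
Proof.
move=> Ct Dt lt; split => //.
move: lt => /existsNP[u /not_implyP[ut /negP]]; rewrite -leNgt => gut.
have gE : g u = g t by apply/le_anti; rewrite gut derivator_nd ?ltW.
have Cm s : u < s -> s < t -> Cg g s by move=> us st; exact: (Cg_flat us st).
have Cmid : Cg g ((t + u) / 2) by apply: Cm; lra.
have [a [b [ab am mb]]] := component_exists Cmid.
exists a; suff <- : b = t%:E by [].
apply/le_anti/andP; split; rewrite leNgt; apply/negP => h.
  apply: Ct; apply: (component_sub ab _ h); apply: lt_le_trans am _.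
  by rewrite lee_fin; lra.
case: b ab mb h => [b|//|//] ab; rewrite !lte_fin => mb bt.
by apply: (component_right_endpoint ab erefl); apply: Cm => //; lra.
Qed.

(** The [g]-derivative at a point of [Cg] is computed at the right endpoint of
    its component, so every statement about it is one about [star t]. *)
Definition star t : R :=
  xget t [set b | exists a, [/\ Cg_component g a b%:E, (a < t%:E)%E & t < b]].

Lemma star_id t : ~ Cg g t -> star t = t.
Proof.
move=> Ct; rewrite /star; case: xgetP => // b _ [a [ab at_ tb]].
by case: Ct; exact: (component_sub ab).
Qed.

Lemma star_uniq (a : \bar R) (b t : R) :
  Cg_component g a b%:E -> (a < t%:E)%E -> t < b -> star t = b.
Proof.
move=> ab at_ tb; rewrite /star; case: xgetP => [b' _ [a' [ab' at' tb']]|].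
  apply/le_anti/andP; split; rewrite leNgt; apply/negP => h.
    apply: (component_right_endpoint ab erefl).
    apply: (component_sub ab') => //.
    by apply: lt_trans at' _; rewrite lte_fin.
  apply: (component_right_endpoint ab' erefl); apply: (component_sub ab) => //.
  by apply: lt_trans at_ _; rewrite lte_fin.
by move=> /(_ b) []; exists a.
Qed.

Lemma star_component (T t : R) : ~ (Ngp g `|` Dg g `|` Cg g) T ->
  t <= T -> Cg g t ->
  exists a, [/\ Cg_component g a (star t)%:E, (a < t%:E)%E, t < star t
              & star t < T].
Proof.
move=> /not_orP[/not_orP[NT DT] CT] tT Ct.
have [a [b [ab at_ tb]]] := component_exists Ct.
have aT : (a < T%:E)%E by apply: lt_le_trans at_ _; rewrite lee_fin.
have [/(component_sub ab aT)//|] := ltP T%:E b.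
case: b ab tb => [b|//|]; last by move=> _; rewrite ltNge leNye.
move=> ab; rewrite lte_fin lee_fin => tb bT; exists a.
rewrite (star_uniq ab at_ tb); split => //.
rewrite lt_neqAle bT andbT; apply/eqP => bE.
by apply: NT; split => //; exists a; rewrite -bE.
Qed.

End endpoints.

(** * Derivatives and the class BD without the exceptional sets *)

Fact product_quotient (K : fieldType) (x0 x y0 y d : K) :
  (x * y - x0 * y0) / d = (x - x0) / d * y0 + x0 * ((y - y0) / d) +
    (x - x0) / d * ((y - y0) / d) * d.
Proof.
have [->|d0] := eqVneq d 0; first by rewrite invr0 !(mulr0, mul0r, addr0).
by field.
Qed.

Section calculus.
Context {R : realType} {F : scalars}.
Variables (g : derivator R) (T : R).
Hypotheses (T_gt0 : 0 < T) (Ngm_0 : ~ Ngm g 0)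
  (T_notin : ~ (Ngp g `|` Dg g `|` Cg g) T).
Local Notation K := (scalar_field R F).
Local Notation star := (star g).
Implicit Types (f h : R -> K) (s t : R).

Let T_notNgp : ~ Ngp g T. Proof. by move=> h; apply: T_notin; left; left. Qed.
Let T_notDg : ~ Dg g T. Proof. by move=> h; apply: T_notin; left; right. Qed.
Let T_notCg : ~ Cg g T. Proof. by move=> h; apply: T_notin; right. Qed.

Lemma Dg_ltT t : t <= T -> Dg g t -> t < T.
Proof. by rewrite le_eqVlt => /predU1P[->|]. Qed.

Lemma le_star t : t <= T -> t <= star t.
Proof.
move=> tT; have [Ct|Ct] := pselect (Cg g t); last by rewrite star_id.
by have [a [_ _ /ltW]] := star_component T_notin tT Ct.
Qed.

Lemma star_leT t : t <= T -> star t <= T.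
Proof.
move=> tT; have [Ct|Ct] := pselect (Cg g t); last by rewrite star_id.
by have [a [_ _ _ /ltW]] := star_component T_notin tT Ct.
Qed.

Lemma star_in t : 0 <= t <= T -> 0 <= star t <= T.
Proof.
by move=> /andP[t0 tT]; rewrite star_leT// (le_trans t0) ?le_star.
Qed.

Lemma star_not_Cg t : t <= T -> ~ Cg g (star t).
Proof.
move=> tT; have [Ct|Ct] := pselect (Cg g t); last by rewrite star_id.
have [a [ab _ _ _]] := star_component T_notin tT Ct.
exact: (component_right_endpoint ab erefl).
Qed.

Lemma g_star t : t <= T -> g (star t) = g t.
Proof.
move=> tT; have [Ct|Ct] := pselect (Cg g t); last by rewrite star_id.
have [a [ab at_ tb _]] := star_component T_notin tT Ct.
by rewrite (component_flat ab at_)// ltW.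
Qed.

(** The standing assumptions on [0] and [T] serve this: [g] is not flat
    on the part of a neighbourhood of [t] that lies in [[0, T]]. *)
Lemma increasing_inside t : 0 <= t <= T -> ~ Cg g t -> ~ Dg g t ->
  (0 < t /\ left_increasing g t) \/ (t < T /\ right_increasing g t).
Proof.
move=> /andP[t0 tT] Ct Dt.
have [rt|rt] := pselect (right_increasing g t).
  have [tltT|Tt] := ltP t T; first by right.
  have tE : t = T by apply/le_anti; rewrite tT.
  left; split; first by rewrite tE.
  apply: contrapT => lt; apply: T_notNgp; rewrite -tE.
  exact: Ngp_of_flat.
have Nt := Ngm_of_flat Ct rt.
left; split; last by case: (not_Cg_increasing Ct).
rewrite lt_neqAle t0 andbT; apply/eqP => tE; apply: Ngm_0.
by rewrite tE.
Qed.

(** A single filter for both kinds of points outside [Cg], so that a rule of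
    calculus need be proved only once. *)
Definition gfilter t : set_system R :=
  if `[< Dg g t >] then within (gadm g T t) t^'+
  else within (gadm g T t) (nbhs t).

Lemma gfilterP t (A : set R) : gfilter t A <->
  exists2 d, 0 < d & forall s, 0 <= s <= T -> t - d < s -> s < t + d ->
    (Dg g t -> t < s) -> g s != g t -> A s.
Proof.
rewrite /gfilter; case: asboolP => Dt; split.
- move=> [d /= d0 dP]; exists d => // s sT ds sd /(_ Dt) ts gst.
  by apply: dP => //=; rewrite ltr_distlC; lra.
- move=> [d d0 dP]; exists d => //= s /=.
  by rewrite ltr_distlC => /andP[h1 h2] ts [sT gs]; apply: dP.
- move=> [d /= d0 dP]; exists d => // s sT ds sd _ gst.
  by apply: dP => //=; rewrite ltr_distlC; lra.
- move=> [d d0 dP]; exists d => //= s /=.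
  by rewrite ltr_distlC => /andP[h1 h2] [sT gs]; apply: dP.
Qed.

Global Instance gfilter_filter t : Filter (gfilter t).
Proof. by rewrite /gfilter; case: asboolP => _; exact: within_filter. Qed.

Lemma gfilter_proper t : 0 <= t <= T -> ~ Cg g t -> ProperFilter (gfilter t).
Proof.
move=> tT Ct; apply: Build_ProperFilter_ex => A /gfilterP[d d0 dA].
have t0T := tT; move: t0T => /andP[t0 t1].
have H : t < T -> right_increasing g t -> exists x, A x.
  move=> tltT rt; pose s := Num.min T (t + d / 2).
  have [sT ts sd] : [/\ s <= T, t < s & s < t + d].
    by rewrite /s ge_min lexx lt_min tltT gt_min; split => //; lra.
  by exists s; apply: dA => //; [lra|lra|rewrite gt_eqF// rt].
have [Dt|Dt] := pselect (Dg g t).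
  by apply: H; [exact: Dg_ltT|exact: Dg_right_increasing].
have [[tpos lt]|[tltT rt]] := increasing_inside tT Ct Dt; last exact: H.
pose s := Num.max 0 (t - d / 2).
have [s0 st ds] : [/\ 0 <= s, s < t & t - d < s].
  by rewrite /s le_max lexx gt_max tpos lt_max; split => //; lra.
by exists s; apply: dA => //; [lra|lra|rewrite lt_eqF// lt].
Qed.

(** The [g]-derivative at a point outside [Cg]. *)
Definition rder f t (l : K) : Prop := gquot g f t @ gfilter t --> l.

Lemma rderP f t l : rder f t l <->
  forall e : R, 0 < e -> exists2 d, 0 < d &
  forall s, 0 <= s <= T -> t - d < s -> s < t + d ->
    (Dg g t -> t < s) -> g s != g t ->
    rnorm (f s - f t - l * of_real F (g s - g t)) < e * `|g s - g t|.
Proof.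
have q s : g s != g t -> forall e,
    (rnorm (gquot g f t s - l) < e) =
    (rnorm (f s - f t - l * of_real F (g s - g t)) < e * `|g s - g t|).
  move=> gst e; have gst0 : 0 < `|g s - g t| by rewrite normr_gt0 subr_eq0.
  have d0 : of_real F (g s - g t) != 0 by rewrite fmorph_eq0 subr_eq0.
  have -> : f s - f t - l * of_real F (g s - g t) =
      (gquot g f t s - l) * of_real F (g s - g t).
    by rewrite /gquot mulrBl mulfVK.
  by rewrite rnormM rnorm_of_real ltr_pM2r.
split=> [/cvg_rnormP fl e /fl/gfilterP[d d0 dP]|fl].
  by exists d => // s sT ds sd Ds gs; rewrite -q//; exact: dP.
apply/cvg_rnormP => e /fl[d d0 dP]; apply/gfilterP.
exists d => // s sT ds sd Ds gs.
by rewrite q//; exact: dP.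
Qed.

Lemma rder_uniq f t l l' : 0 <= t <= T -> ~ Cg g t ->
  rder f t l -> rder f t l' -> l = l'.
Proof.
move=> tT Ct; have FF := gfilter_proper tT Ct.
exact: (@norm_cvg_unique _ _ _ (fmap_proper_filter _ FF)).
Qed.

Lemma eq_rder f h t l : 0 <= t <= T ->
  (forall s, 0 <= s <= T -> f s = h s) -> rder f t l -> rder h t l.
Proof.
move=> tT fh /rderP fl; apply/rderP => e /fl[d d0 dP]; exists d => // s sT.
by rewrite -!fh//; exact: dP.
Qed.

(** If the right endpoint [b] of a component is not a jump, then the filters
    of the two definitions differ by points on the left of [b]; but there [g]
    takes the value [g b], so that none of them is admissible. *)
Lemma is_gderiveP f t l : 0 <= t <= T ->
  is_gderive g T f t l <-> rder f (star t) l.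
Proof.
move=> tT; have t1 : t <= T by case/andP: tT.
have [Ct|Ct] := pselect (Cg g t); last first.
  rewrite star_id// /rder /gfilter; case: asboolP => Dt; split.
  - case=> [[/not_orP[//]]|[]//|[a [b [ab at_ tb _]]]].
    by case: Ct; exact: (component_sub ab at_ tb).
  - by move=> fl; apply: Or32.
  - case=> [[]//|[]//|[a [b [ab at_ tb _]]]].
    by case: Ct; exact: (component_sub ab at_ tb).
  - by move=> fl; apply: Or31; split => // -[].
have [a [ab at_ tb _]] := star_component T_notin t1 Ct.
have fE : gfilter (star t) = within (gadm g T (star t)) (star t)^'+.
  rewrite /gfilter; case: asboolP => // Db; apply/seteqP; split => A /=.
    by apply: cvg_within.
  move=> [d /= d0 dP]; exists (Num.min d (star t - t)) => /=.
    by rewrite lt_min d0 subr_gt0.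
  move=> s /=; rewrite lt_min => /andP[sd st] [sT gs].
  apply: dP => //=; rewrite ltNge; apply/negP => sb; move/eqP: gs; apply.
  rewrite (component_flat ab)//; apply: lt_trans at_ _; rewrite lte_fin.
  by move: st; rewrite ltr_distlC; lra.
split.
  case=> [[/not_orP[_ //]]|[/(Cg_not_Dg Ct)//]|[a' [b [ab' at' tb']]]].
  by rewrite /rder fE (star_uniq ab' at' tb').
by rewrite /rder fE => fl; apply: Or33; exists a, (star t).
Qed.

Lemma gderive_rder f t : 0 <= t <= T -> gderivable g T f t ->
  rder f (star t) (gderive g T f t).
Proof.
move=> tT [l fl]; apply/is_gderiveP => //; rewrite /gderive.
by case: xgetP => // /(_ l).
Qed.

Lemma rder_gderivable f t l : 0 <= t <= T -> rder f (star t) l ->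
  gderivable g T f t.
Proof. by move=> tT fl; exists l; exact/is_gderiveP. Qed.

Lemma rder_gderiveE f t l : 0 <= t <= T -> rder f (star t) l ->
  gderive g T f t = l.
Proof.
move=> tT fl; have t1 : t <= T by case/andP: tT.
apply: (rder_uniq (star_in tT) (star_not_Cg t1) _ fl).
by apply: gderive_rder => //; exact: (rder_gderivable tT fl).
Qed.

Lemma cvg_jump t : ~ Cg g t -> g s - g t @[s --> gfilter t] --> jump g t.
Proof.
move=> Ct; apply/cvgrPdist_lt => e e0; apply/gfilterP.
have [d1 d10 d1P] := derivator_right g t e0.
have [d2 d20 d2P] := derivator_left g t e0.
exists (Num.min d1 d2); first by rewrite lt_min d10.
set d := Num.min d1 d2; have [dd1 dd2] : d <= d1 /\ d <= d2.
  by rewrite /d !ge_min !lexx orbT.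
move=> s sT ds sd Ds gs; have [st|ts|st] := ltgtP s t.
- have Dt : ~ Dg g t by move/Ds; rewrite ltNge (ltW st).
  rewrite jump_eq0// sub0r normrN ler0_norm ?subr_le0 ?derivator_nd ?ltW//.
  by rewrite opprB; apply: d2P; [lra|exact: ltW].
- rewrite distrC ger0_norm ?subr_ge0 ?jump_le// ltrBlDl.
  by apply: d1P => //; lra.
- by rewrite st eqxx in gs.
Qed.

(** The last term is the one that the classical rule lacks:
    at a jump, the increments of [f] and [h] do not vanish. *)
Lemma rderM f h t l m : ~ Cg g t -> rder f t l -> rder h t m ->
  rder (fun s => f s * h s) t
    (l * h t + f t * m + l * m * of_real F (jump g t)).
Proof.
move=> Ct fl hm; rewrite /rder.
have -> : gquot g (fun s => f s * h s) t = fun s => gquot g f t s * h t +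
    f t * gquot g h t s +
    gquot g f t s * gquot g h t s * of_real F (g s - g t).
  by apply/funext => s; exact: product_quotient.
apply: cvgD; first by apply: cvgD; apply: cvgM => //; exact: cvg_cst.
by apply: cvgM; [exact: cvgM|apply: cvg_of_real; exact: cvg_jump].
Qed.

End calculus.

Section bounded_functions.
Context {R : realType} {F : scalars}.
Variables (g : derivator R) (T : R).
Hypotheses (T_gt0 : 0 < T) (Ngm_0 : ~ Ngm g 0)
  (T_notin : ~ (Ngp g `|` Dg g `|` Cg g) T).
Local Notation K := (scalar_field R F).
Local Notation star := (star g).
Implicit Types (f h : R -> K) (s t : R).

Definition lfilter t : set_system R := within `[0, T]%classic t^'-.
Definition rfilter t : set_system R := within `[0, T]%classic t^'+.

Lemma lfilterP t (A : set R) : lfilter t A <->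
  exists2 d, 0 < d & forall s, 0 <= s <= T -> t - d < s -> s < t -> A s.
Proof.
split=> -[d /= d0 dP]; exists d => //.
  move=> s sT ds st; apply: dP => //=; rewrite ?in_itv//= ltr_distlC; lra.
move=> s /=; rewrite ltr_distlC in_itv/= => /andP[h1 h2] st sT.
exact: dP.
Qed.

Lemma rfilterP t (A : set R) : rfilter t A <->
  exists2 d, 0 < d & forall s, 0 <= s <= T -> t < s -> s < t + d -> A s.
Proof.
split=> -[d /= d0 dP]; exists d => //.
  move=> s sT ts sd; apply: dP => //=; rewrite ?in_itv//= ltr_distlC; lra.
move=> s /=; rewrite ltr_distlC in_itv/= => /andP[h1 h2] st sT.
exact: dP.
Qed.

Global Instance lfilter_filter t : Filter (lfilter t).
Proof. exact: within_filter. Qed.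

Global Instance rfilter_filter t : Filter (rfilter t).
Proof. exact: within_filter. Qed.

Definition bounded_on_segment f :=
  exists M, forall t, 0 <= t <= T -> rnorm (f t) <= M.

(** Continuity with respect to [g] from a side on which [g] increases strictly
    is ordinary continuity from that side. *)
Definition side_continuous f t :=
  (left_increasing g t -> f @ lfilter t --> f t) /\
  (right_increasing g t -> f @ rfilter t --> f t).

Lemma bounded_on_segmentP f :
  [bounded f t | t in `[0, T]%classic] <-> bounded_on_segment f.
Proof.
have Pr : ProperFilter (globally `[0, T]%classic).
  by apply: (@globally_properfilter _ _ 0); rewrite /= in_itv/= lexx ltW.
split=> [/ex_bound[M fM]|[M fM]]; last first.
  apply/ex_bound; exists (of_real F M) => t /=; rewrite in_itv/= => /fM.
  by rewrite normE ler_of_real.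
exists (rnorm M) => t tT; rewrite -(@ler_of_real R F) -!normE.
have fMt : `|f t| <= M by apply: fM; rewrite /= in_itv.
by rewrite (ger0_norm (le_trans (normr_ge0 _) fMt)).
Qed.

Lemma left_gcontinuous_atP f t : ~ Cg g t -> left_increasing g t ->
  left_gcontinuous_at g T f t <-> f @ lfilter t --> f t.
Proof.
move=> Ct lt; split.
  move=> fc; apply/cvg_rnormP => e /(pos_of_real (F := F)) /fc[d d0 dP].
  have [d' d'0 d'P] := derivator_left g t d0.
  apply/lfilterP; exists d' => // s sT ds st.
  rewrite -(@ltr_of_real R F) -normE; apply: dP => //.
  by apply: d'P => //; exact: ltW.
move=> /cvg_rnormP fc e /pos_of_realP[e' /fc /lfilterP[d d0 dP] ->].
exists (g t - g (t - d)); first by rewrite subr_gt0 lt// ltrBlDr ltrDl.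
move=> s sT st gts; rewrite normE ltr_of_real; apply: dP => //.
by rewrite ltNge; apply/negP => /(derivator_nd g); lra.
Qed.

Lemma right_gcontinuous_atP f t : ~ Dg g t -> right_increasing g t ->
  right_gcontinuous_at g T f t <-> f @ rfilter t --> f t.
Proof.
move=> Dt rt; split.
  move=> fc; apply/cvg_rnormP => e /(pos_of_real (F := F)) /fc[d d0 dP].
  have [d' d'0 d'P] := derivator_right g t d0.
  apply/rfilterP; exists d' => // s sT ts sd.
  rewrite -(@ltr_of_real R F) -normE; apply: dP => //.
  by rewrite -[d]add0r -(jump_eq0 Dt); exact: d'P.
move=> /cvg_rnormP fc e /pos_of_realP[e' /fc /rfilterP[d d0 dP] ->].
exists (g (t + d) - g t); first by rewrite subr_gt0 rt// ltrDl.
move=> s sT ts gts; rewrite normE ltr_of_real; apply: dP => //.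
by rewrite ltNge; apply/negP => /(derivator_nd g); lra.
Qed.

Lemma gcontinuous_atP f t : left_increasing g t -> right_increasing g t ->
  gcontinuous_at g T f t <->
  left_gcontinuous_at g T f t /\ right_gcontinuous_at g T f t.
Proof.
move=> lt rt; split=> [fc|[fl fr] e e0].
  split=> e /fc[d d0 dP]; exists d => // s sT st gd.
    by rewrite distrC dP// ger0_norm// subr_ge0 derivator_nd// ltW.
  by rewrite distrC dP// distrC ger0_norm// subr_ge0 derivator_nd// ltW.
have [d1 d10 d1P] := fl _ e0; have [d2 d20 d2P] := fr _ e0.
exists (Num.min d1 d2); first by rewrite lt_min d10.
move=> s sT; rewrite lt_min => /andP[h1 h2]; rewrite distrC.
have [st|ts|->] := ltgtP s t; last by rewrite subrr normr0.
- by apply: d1P => //; apply: le_lt_trans h1; exact: ler_norm.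
- by apply: d2P => //; apply: le_lt_trans h2; rewrite distrC ler_norm.
Qed.

(** The sets [Ngm] and [Ngp] consist of the points outside [Cg] and [Dg] that
    have [g] flat on the right, respectively on the left. *)
Lemma BDP f : BD g T f <->
  bounded_on_segment f /\
  forall t, 0 <= t <= T -> ~ Cg g t -> ~ Dg g t -> side_continuous f t.
Proof.
split=> [[/bounded_on_segmentP fM fc fl fr]|[/bounded_on_segmentP fM fc]].
  split=> // t tT Ct Dt.
  have [Lt|Lt] := pselect (left_increasing g t); last first.
    have Nt := Ngp_of_flat Ct Dt Lt; split=> // rt.
    by apply/right_gcontinuous_atP => //; exact: fr.
  have [rt|rt] := pselect (right_increasing g t); last first.
    have Nt := Ngm_of_flat Ct rt; split=> // _.
    by apply/left_gcontinuous_atP => //; exact: fl.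
  have /(gcontinuous_atP _ Lt rt)[fl' fr'] : gcontinuous_at g T f t.
    apply: fc => // -[[//|[Nt|Nt]]|//].
      exact: (Ngm_not_right_increasing Nt).
    exact: (Ngp_not_left_increasing Nt).
  by split=> _; [apply/left_gcontinuous_atP|apply/right_gcontinuous_atP].
split=> // t tT.
- move=> /not_orP[/not_orP[Ct /not_orP[Nm Np]] Dt].
  have Lt : left_increasing g t by apply: contrapT => /(Ngp_of_flat Ct Dt).
  have Rt : right_increasing g t by apply: contrapT => /(Ngm_of_flat Ct).
  have [fl fr] := fc t tT Ct Dt; apply/gcontinuous_atP => //.
  by split; [apply/left_gcontinuous_atP/fl|apply/right_gcontinuous_atP/fr].
- move=> Nt; have Ct := Ngm_not_Cg Nt; have [_ Dt] := Nt.
  have Lt : left_increasing g t.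
    by have [//|/(Ngm_not_right_increasing Nt)] := not_Cg_increasing Ct.
  by apply/left_gcontinuous_atP => //; have [+ _] := fc t tT Ct Dt; apply.
- move=> Nt; have Ct := Ngp_not_Cg Nt; have [_ Dt] := Nt.
  have Rt : right_increasing g t.
    by have [/(Ngp_not_left_increasing Nt)|//] := not_Cg_increasing Ct.
  by apply/right_gcontinuous_atP => //; have [_] := fc t tT Ct Dt; apply.
Qed.

Lemma eq_BD f h : (forall t, 0 <= t <= T -> f t = h t) -> BD g T f -> BD g T h.
Proof.
move=> fh /BDP[[M fM] fc]; apply/BDP; split.
  by exists M => t tT; rewrite -fh//; exact: fM.
move=> t tT Ct Dt; have [fl fr] := fc t tT Ct Dt.
rewrite /side_continuous -fh//.
split=> [/fl|/fr] /cvg_rnormP fe; apply/cvg_rnormP => e /fe.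
  move=> /lfilterP[d d0 dP]; apply/lfilterP; exists d => // s sT.
  by rewrite /= -fh//; exact: dP.
move=> /rfilterP[d d0 dP]; apply/rfilterP; exists d => // s sT.
by rewrite /= -fh//; exact: dP.
Qed.

Lemma BD_cst (c : K) : BD g T (fun=> c).
Proof.
apply/BDP; split; first by exists (rnorm c).
by move=> t _ _ _; split=> _; exact: cvg_cst.
Qed.

Lemma BDM f h : BD g T f -> BD g T h -> BD g T (fun t => f t * h t).
Proof.
move=> /BDP[[M fM] fc] /BDP[[N hN] hc]; apply/BDP; split.
  by exists (M * N) => t tT; rewrite rnormM ler_pM ?rnorm_ge0 ?fM ?hN.
move=> t tT Ct Dt; have [fl fr] := fc t tT Ct Dt; have [hl hr] := hc t tT Ct Dt.
by split=> [L|L]; apply: cvgM; auto.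
Qed.

Lemma BDB f h : BD g T f -> BD g T h -> BD g T (fun t => f t - h t).
Proof.
move=> /BDP[[M fM] fc] /BDP[[N hN] hc]; apply/BDP; split.
  by exists (M + N) => t tT; rewrite (le_trans (rnormB _ _))// lerD ?fM ?hN.
move=> t tT Ct Dt; have [fl fr] := fc t tT Ct Dt; have [hl hr] := hc t tT Ct Dt.
by split=> [L|L]; apply: cvgB; auto.
Qed.

(** [g]-derivatives have this form. The values of [f] on [Cg] do not
    enter, and [star] moves neighbours of [t] to neighbours of [t]. *)
Lemma BD_star f : BD g T f -> BD g T (f \o star).
Proof.
move=> /BDP[[M fM] fc]; apply/BDP; split.
  by exists M => t tT; apply: fM; exact: star_in.
move=> t tT Ct Dt; have [fl fr] := fc t tT Ct Dt.
have t1 : t <= T by case/andP: tT.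
split; rewrite /= (star_id Ct).
  move=> Lt; apply/cvg_rnormP => e e0; apply/lfilterP.
  have /cvg_rnormP/(_ _ e0)/lfilterP[d d0 dP] := fl Lt.
  exists d => // s sT ds st; have s1 : s <= T by case/andP: sT.
  apply: dP; [exact: star_in|by rewrite (lt_le_trans ds)// (le_star T_notin)|].
  rewrite ltNge; apply/negP => ts; have := Lt _ st.
  by rewrite -(g_star T_notin s1) ltNge derivator_nd.
move=> Rt; apply/cvg_rnormP => e e0; apply/rfilterP.
have /cvg_rnormP/(_ _ e0)/rfilterP[d d0 dP] := fr Rt.
have gd : 0 < g (t + d) - g t by rewrite subr_gt0 Rt// ltrDl.
have [d' d'0 d'P] := derivator_right g t gd.
exists d' => // s sT ts sd; have s1 : s <= T by case/andP: sT.
apply: dP; [exact: star_in|by rewrite (lt_le_trans ts)// (le_star T_notin)|].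
rewrite ltNge; apply/negP => /(derivator_nd g).
rewrite (g_star T_notin)// leNgt.
by have := d'P _ ts sd; rewrite jump_eq0// add0r ltrD2r => ->.
Qed.

Definition g_lipschitz f := exists C, forall s t, 0 <= s <= T -> 0 <= t <= T ->
  rnorm (f s - f t) <= C * `|g s - g t|.

Lemma BD_lipschitz f : g_lipschitz f -> BD g T f.
Proof.
move=> [C' fC']; have [C C0 fC] : exists2 C, 0 < C & forall s t,
    0 <= s <= T -> 0 <= t <= T -> rnorm (f s - f t) <= C * `|g s - g t|.
  exists (Num.max 1 C') => [|s t sT tT]; first by rewrite lt_max ltr01.
  by rewrite (le_trans (fC' _ _ sT tT))// ler_wpM2r// le_max lexx orbT.
have T0 : (0 : R) <= 0 <= T by rewrite lexx ltW.
apply/BDP; split.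
  exists (rnorm (f 0) + C * (g T - g 0)) => t tT.
  rewrite -[f t](subrK (f 0)) (le_trans (rnormD _ _))// addrC lerD2l.
  rewrite (le_trans (fC _ _ tT T0))// ler_pM2l//.
  move: tT => /andP[t0 t1].
  by rewrite ger0_norm ?subr_ge0 ?derivator_nd// lerD2r derivator_nd.
move=> t tT Ct Dt; split=> _; apply/cvg_rnormP => e e0.
  have [d d0 dP] := derivator_left g t (divr_gt0 e0 C0).
  apply/lfilterP; exists d => // s sT ds st.
  rewrite (le_lt_trans (fC _ _ sT tT))// mulrC -ltr_pdivlMr// distrC.
  by rewrite ger0_norm ?subr_ge0 ?derivator_nd ?ltW// dP// ltW.
have [d d0 dP] := derivator_right g t (divr_gt0 e0 C0).
apply/rfilterP; exists d => // s sT ts sd.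
rewrite (le_lt_trans (fC _ _ sT tT))// mulrC -ltr_pdivlMr//.
rewrite ger0_norm ?subr_ge0 ?derivator_nd ?ltW//.
by have := dP _ ts sd; rewrite jump_eq0// add0r.
Qed.

Lemma W11_lipschitz f : g_lipschitz f -> W11 g T f.
Proof.
move=> [C' fC']; have [C C0 fC] : exists2 C, 0 < C & forall s t,
    0 <= s <= T -> 0 <= t <= T -> rnorm (f s - f t) <= C * `|g s - g t|.
  exists (Num.max 1 C') => [|s t sT tT]; first by rewrite lt_max ltr01.
  by rewrite (le_trans (fC' _ _ sT tT))// ler_wpM2r// le_max lexx orbT.
move=> e /pos_of_realP[e' e'0 ->]; exists (e' / C); first exact: divr_gt0.
move=> n a b ab _ sumd; under eq_bigr do rewrite normE.
rewrite -rmorph_sum ltr_of_real; apply: (@le_lt_trans _ _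
    (\sum_(j < n) C * (g (b j) - g (a j)))).
  apply: ler_sum => j _; have [aj abj bj] := ab j.
  rewrite (le_trans (fC _ _ _ _)) ?ler_pM2l//.
  - by rewrite bj (le_trans aj) ?ltW.
  - by rewrite aj (le_trans _ bj) ?ltW.
  - by rewrite ger0_norm// subr_ge0 derivator_nd ?ltW.
by rewrite -mulr_sumr mulrC -ltr_pdivlMr.
Qed.

End bounded_functions.

(** * Existence of the exponential *)

Lemma ltn_count_sub (T : eqType) (a b : pred T) (s : seq T) q :
  subpred a b -> q \in s -> b q -> ~~ a q -> (count a s < count b s)%N.
Proof.
move=> ab qs bq aq.
have -> : count a s = count a (seq.filter b s).
  rewrite count_filter; apply: eq_count => x /=.
  by case ax : (a x) => //=; rewrite (ab _ ax).
rewrite -[count b s]size_filter ltn_neqAle count_size andbT -all_count.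
by apply/negP => /allP/(_ q); rewrite mem_filter bq qs (negPf aq) => /(_ isT).
Qed.

(** Induction on the number of points of [P] strictly between [p] and [s]. *)
Lemma cell_induction (R : realType) (P : seq R) (S : R -> R -> Prop) (p s : R) :
  p \in P -> p <= s ->
  (forall x y, x \in P -> p <= x -> x <= y -> y <= s ->
     (forall q, q \in P -> ~~ (x < q < y)) -> S x y) ->
  (forall x y z, S x y -> S y z -> S x z) ->
  S p s.
Proof.
move=> + + + Strans; have [n] := ubnP (count (fun q => p < q < s) P).
elim: n p s => // n IHn p s; rewrite ltnS => cn pP ps Scell.
have [|/hasPn noq] := boolP (has (fun q => p < q < s) P).
  move=> /hasP[q qP /andP[pq qs]].
  have cq (x y : R) : p <= x -> y <= s -> ~~ (x < q < y) ->
      (count (fun r => (x < r < y)%R) P < n)%N.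
    move=> px ys xqy; apply: leq_trans cn.
    apply: (@ltn_count_sub _ _ _ _ q) => //; last by rewrite pq.
    by move=> r /andP[xr ry]; rewrite (le_lt_trans px)// (lt_le_trans ry).
  apply: (Strans _ q).
    apply: IHn => //; [by apply: cq; rewrite ?ltxx ?andbF// ltW|exact: ltW|].
    by move=> x y xP px xy yq; apply: Scell => //; rewrite (le_trans yq)// ltW.
  apply: IHn => //; [by apply: cq; rewrite ?ltxx// ltW|exact: ltW|].
  by move=> x y xP qx; apply: Scell => //; rewrite (le_trans _ qx)// ltW.
exact: Scell.
Qed.

Fact euler_step (K : comNzRingType) (w b c d : K) :
  w * (1 + b * d) - w - c * d = (b * w - c) * d.
Proof. by ring. Qed.

Fact increment_trans (K : comNzRingType) (x y z c d e : K) :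
  z - x - c * (d + e) = (z - y - c * d) + (y - x - c * e).
Proof. by ring. Qed.

Section exponential.
Context {R : realType} {F : scalars}.
Variables (g : derivator R) (T : R).
Local Notation K := (scalar_field R F).
Local Notation rl := (of_real F).
Variable beta : R -> K.
Variable B : R.
Hypothesis T_gt0 : 0 < T.
Hypothesis betaB : forall t, 0 <= t <= T -> rnorm (beta t) <= B.

(** Euler's polygon for [v' = beta v] with nodes [P], characterized by its
    values between consecutive nodes. *)
Definition euler (P : seq R) (v : R -> K) : Prop :=
  v 0 = 1 /\ forall p s, p \in P -> 0 <= p -> p <= s ->
    (forall q, q \in P -> ~~ (p < q < s)) ->
    v s = v p * (1 + beta p * rl (g s - g p)).

(** By induction on the nodes from left to right: the polygon is extended
    beyond its last node [q] in the direction prescribed there. *)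
Lemma euler_exists P : exists v, euler P v.
Proof.
suff [v [v0 vP]] : exists v, euler (sort <=%R [seq p <- P | 0 <= p]) v.
  exists v; split=> // p s pP p0 ps Pps; apply: vP => //.
    by rewrite mem_sort mem_filter p0.
  by move=> q; rewrite mem_sort mem_filter => /andP[_]; exact: Pps.
have : all (fun p => 0 <= p) (sort <=%R [seq p <- P | 0 <= p]).
  by rewrite all_sort filter_all.
have : pairwise <=%R (sort <=%R [seq p <- P | 0 <= p]).
  by rewrite -(sorted_pairwise le_trans) sort_sorted//; exact: le_total.
elim/last_ind: (sort _ _) => [_ _|Q q IH]; first by exists (fun=> 1).
rewrite pairwise_rcons all_rcons => /andP[/allP Qq pwQ] /andP[q0 Q0].
have [v [v0 vQ]] := IH pwQ Q0.
exists (fun s => if s <= q then v s else v q * (1 + beta q * rl (g s - g q))).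
split; first by rewrite q0.
move=> p s; rewrite mem_rcons inE => pQ p0 ps noq.
have pq : p <= q by case/predU1P: pQ => [->//|/Qq].
rewrite pq; have [sq|qs] := leP s q; last first.
  suff -> : p = q by [].
  have := noq q; rewrite mem_rcons mem_head qs andbT => /(_ isT).
  by rewrite -leNgt => qp; apply/le_anti; rewrite pq.
case/predU1P: pQ => [pE|pQ].
  have -> : s = p by apply/le_anti; rewrite ps pE sq.
  by rewrite subrr rmorph0 mulr0 addr0 mulr1.
by apply: vQ => // r rQ; apply: noq; rewrite mem_rcons inE rQ orbT.
Qed.

(** The error bound is the increment of a function [G], which makes the
    estimate additive over adjacent intervals. The estimates that determine
    the limit are instances: [G] is a multiple of [g], except at a jump. *)
Lemma euler_estimate P v c (G : R -> R) p s :
  euler P v -> p \in P -> 0 <= p -> p <= s ->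
  (forall x y, x \in P -> p <= x -> x < y -> y <= s ->
     rnorm (beta x * v x - c) * (g y - g x) <= G y - G x) ->
  rnorm (v s - v p - c * rl (g s - g p)) <= G s - G p.
Proof.
move=> [_ vP] pP p0 ps cG.
pose S x y := rnorm (v y - v x - c * rl (g y - g x)) <= G y - G x.
apply: (@cell_induction R P S) => // [x y xP px xy ys noq|x y z].
  rewrite /S; move: xy noq; rewrite le_eqVlt => /predU1P[<-|xy] noq.
    by rewrite !subrr rmorph0 mulr0 subr0 rnorm0.
  rewrite (vP x y)// ?(le_trans p0)// ?(ltW xy)//.
  have -> : v x * (1 + beta x * rl (g y - g x)) - v x - c * rl (g y - g x) =
      (beta x * v x - c) * rl (g y - g x).
    exact: euler_step.
  rewrite rnormM rnorm_of_real ger0_norm; first exact: cG.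
  by rewrite subr_ge0 derivator_nd// ltW.
rewrite /S => xy yz.
have -> : v z - v x - c * rl (g z - g x) =
    (v z - v y - c * rl (g z - g y)) + (v y - v x - c * rl (g y - g x)).
  by rewrite -(subrKA (g y) (g z)) rmorphD (increment_trans _ (v y)).
by rewrite (le_trans (rnormD _ _))//; lra.
Qed.


Let M := expR (B * (g T - g 0)).

Let B_ge0 : 0 <= B.
Proof.
by apply: le_trans (rnorm_ge0 (beta 0)) (betaB _); rewrite lexx ltW.
Qed.

Let M_gt0 : 0 < M. Proof. exact: expR_gt0. Qed.

Lemma euler_bounded P v s : euler P v -> 0 \in P -> 0 <= s <= T ->
  rnorm (v s) <= M.
Proof.
move=> [v0 vP] P0 /andP[s0 sT].
pose S x y := rnorm (v y) <= rnorm (v x) * expR (B * (g y - g x)).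
suff S0s : S 0 s.
  move: S0s; rewrite /S v0 rnorm1 mul1r => /le_trans; apply.
  by rewrite ler_expR ler_wpM2l// lerD2r derivator_nd.
apply: (@cell_induction R P S) => // [x y xP x0 xy ys noq|x y z].
  rewrite /S (vP x y)// rnormM ler_wpM2l ?rnorm_ge0//.
  rewrite (le_trans (rnormD _ _))// rnorm1 rnormM rnorm_of_real.
  have gxy : 0 <= g y - g x by rewrite subr_ge0 derivator_nd.
  rewrite ger0_norm// (le_trans _ (expR_ge1Dx _))// lerD2l ler_wpM2r//.
  by rewrite betaB// x0 (le_trans xy) ?(le_trans ys).
rewrite /S => xy /le_trans; apply.
have -> : expR (B * (g z - g x)) =
    expR (B * (g y - g x)) * expR (B * (g z - g y)).
  by rewrite -expRD -mulrDr [g y - _ + _]addrC subrKA.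
by rewrite mulrA ler_wpM2r ?expR_ge0.
Qed.

Lemma euler_increment P v p s : euler P v -> 0 \in P -> p \in P ->
  0 <= p -> p <= s -> s <= T -> rnorm (v s - v p) <= B * M * (g s - g p).
Proof.
move=> vP P0 pP p0 ps sT.
have := @euler_estimate P v 0 (fun x => B * M * g x) p s vP pP p0 ps.
rewrite mul0r subr0 -mulrBr; apply => x y xP px xy ys.
rewrite subr0 -mulrBr ler_wpM2r ?subr_ge0 ?derivator_nd ?(ltW xy)//.
have xT : 0 <= x <= T.
  by rewrite (le_trans p0)//= (le_trans (ltW xy)) ?(le_trans ys).
by rewrite rnormM ler_pM ?rnorm_ge0 ?betaB ?(euler_bounded vP).
Qed.

(** Refinement of the set of nodes is directed, and every given point is a
    node in the end. Compactness yields a limit with no rate of convergence,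
    and it inherits every estimate that holds for all fine polygons. *)
Lemma euler_limit : exists v : R -> K, v 0 = 1 /\
  forall p s t a (G : R -> R), 0 <= p -> p <= s -> s <= T -> 0 <= t <= T ->
  (forall P u, euler P u -> 0 \in P -> p \in P -> s \in P -> t \in P ->
     forall x y, x \in P -> p <= x -> x < y -> y <= s ->
     rnorm (beta x * u x - a * u t) * (g y - g x) <= G y - G x) ->
  rnorm (v s - v p - a * v t * rl (g s - g p)) <= G s - G p.
Proof.
have [w wP] := choice euler_exists.
pose Fin : set_system (seq R) :=
  [set A | exists P0 : seq R, forall P : seq R, {subset P0 <= P} -> A P].
have Fin_filter : Filter Fin.
  split=> [|A1 A2 [P1 AP1] [P2 AP2]|A1 A2 A12 [P1 AP1]].
  - by exists [::].
  - exists (P1 ++ P2) => P sP; split.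
      by apply: AP1 => x xP; apply: sP; rewrite mem_cat xP.
    by apply: AP2 => x xP; apply: sP; rewrite mem_cat xP orbT.
  - by exists P1 => P /AP1/A12.
have FinF : ProperFilter Fin.
  by apply: Build_ProperFilter_ex => A [P0 AP]; exists P0; exact: AP.
have [U [UU FinU]] := ultraFilterLemma FinF.
have Unodes (Q : seq R) : \forall P \near U, {subset Q <= P}.
  by apply: FinU; exists Q.
have lim_ex s : exists l : K, 0 <= s <= T -> w P s @[P --> U] --> l.
  have [sT|sT] := boolP (0 <= s <= T); last by exists 0.
  have [|l wl] := @ultra_cvg_bounded R F _ U _
      (fun P => if 0 \in P then w P s else 0) M.
    move=> P; case: ifP => P0; first exact: (euler_bounded (wP P)).
    by rewrite rnorm0 ltW.
  exists l => _; apply: cvg_trans wl; apply: near_eq_cvg.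
  by have := Unodes [:: 0]; apply: filterS => P ->//; rewrite mem_head.
have [v vl] := choice lim_ex.
have T0 : (0 : R) <= 0 <= T by rewrite lexx ltW.
exists v; split.
  have := vl _ T0; rewrite (_ : (fun P => w P 0) = fun=> 1).
    by move=> w0; apply/esym; apply: norm_cvg_unique (cvg_cst _) w0.
  by apply/funext => P; have [] := wP P.
move=> p s t a G p0 ps sT tT H.
apply: (@cvg_rnorm_le _ _ _ U _
  (fun P => w P s - w P p - a * w P t * rl (g s - g p))).
  apply: cvgB; last apply: cvgM; last exact: cvg_cst.
    by apply: cvgB; apply: vl; rewrite ?p0 ?(le_trans p0)//= (le_trans ps).
  by apply: cvgM; [exact: cvg_cst|exact: vl].
have := Unodes [:: 0; p; s; t]; apply: filterS => P sP.
have inP x : x \in [:: 0; p; s; t] -> x \in P by exact: sP.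
have [P0 pP sP' tP] : [/\ 0 \in P, p \in P, s \in P & t \in P].
  by split; apply: inP; rewrite !inE eqxx ?orbT.
exact: euler_estimate (wP P) pP p0 ps (H _ _ (wP P) P0 pP sP' tP).
Qed.

End exponential.

Fact product_increment (K : comNzRingType) (b0 b w0 w : K) :
  b * w - b0 * w0 = (b - b0) * w + b0 * (w - w0).
Proof. by ring. Qed.

Section exponential_derivative.
Context {R : realType} {F : scalars}.
Variables (g : derivator R) (T : R).
Hypothesis T_gt0 : 0 < T.
Local Notation K := (scalar_field R F).
Local Notation rl := (of_real F).

(** The estimate at [t] bounds the variation of [beta v] between [t] and its
    neighbours, which is small by one-sided continuity when [t] is not a jump.
    When it is, [beta] is arbitrary beside [t], but [t] is a node, so that the
    jump of the polygon is exact, and what [g] adds to its jump is small. *)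
Lemma exponential_exists (beta : R -> K) : BD g T beta ->
  exists v : R -> K, [/\ v 0 = 1, g_lipschitz g T v &
    forall t, 0 <= t <= T -> ~ Cg g t -> rder g T v t (beta t * v t)].
Proof.
move=> /(BDP g T_gt0)[[B betaB] betaC].
have [v [v0 vP]] := euler_limit g T_gt0 betaB.
set M := expR (B * (g T - g 0)).
have M0 : 0 < M by exact: expR_gt0.
have B0 : 0 <= B.
  by apply: le_trans (rnorm_ge0 (beta 0)) (betaB _ _); rewrite lexx ltW.
have uM := fun P u s => @euler_bounded R F g T beta B T_gt0 betaB P u s.
have uL := fun P u p s => @euler_increment R F g T beta B T_gt0 betaB P u p s.
rewrite -/M in uM uL.
have vL p s : 0 <= p -> p <= s -> s <= T ->
    rnorm (v s - v p) <= B * M * (g s - g p).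
  move=> p0 ps sT; have p0T : 0 <= p <= T by rewrite p0 (le_trans ps).
  have := vP p s p 0 (fun x => B * M * g x) p0 ps sT p0T.
  rewrite !mul0r subr0 -mulrBr; apply => P u uP P0 pP _ _ x y xP px xy ys.
  rewrite mul0r subr0 -mulrBr ler_wpM2r ?subr_ge0 ?derivator_nd ?(ltW xy)//.
  have xT : 0 <= x <= T.
    by rewrite (le_trans p0)//= (le_trans (ltW xy)) ?(le_trans ys).
  by rewrite rnormM ler_pM ?rnorm_ge0 ?betaB ?(uM P).
exists v; split=> //.
  exists (B * M) => s t /andP[s0 sT] /andP[t0 tT].
  have [st|/ltW ts] := leP s t.
    rewrite rnorm_distC distrC ger0_norm ?subr_ge0 ?derivator_nd//.
    exact: vL.
  by rewrite ger0_norm ?subr_ge0 ?derivator_nd//; exact: vL.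
move=> t tT Ct; have /andP[t0 t1] := tT.
(* The constants balance the two terms of
   [b u x - b0 u t = (b - b0) u x + b0 (u x - u t)]; the addition of [1]
   covers the case [B = 0]. *)
have near_estimate e p s : 0 < e -> 0 <= p -> p <= s -> s <= T ->
    (forall x, p <= x -> x < s -> rnorm (beta x - beta t) <= e / (4 * M) /\
       `|g x - g t| <= e / (4 * (B * B * M + 1))) ->
    rnorm (v s - v p - beta t * v t * rl (g s - g p)) <= e / 2 * (g s - g p).
  move=> e0 p0 ps sT near_t; rewrite mulrBr.
  apply: (vP p s t (beta t) (fun x => e / 2 * g x)) => // P u uP P0 pP sP tP.
  move=> x y xP px xy ys; rewrite -mulrBr.
  rewrite ler_wpM2r ?subr_ge0 ?derivator_nd ?(ltW xy)//.
  have [b1 g1] := near_t x px (lt_le_trans xy ys).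
  have x0 : 0 <= x by exact: le_trans px.
  have x1 : x <= T by rewrite (le_trans (ltW xy)) ?(le_trans ys).
  have ux : rnorm (u x) <= M by apply: (uM P); rewrite ?x0.
  have uxt : rnorm (u x - u t) <= B * M * `|g x - g t|.
    have [xt|/ltW tx] := leP x t.
      rewrite rnorm_distC distrC ger0_norm ?subr_ge0 ?derivator_nd//.
      exact: (uL P).
    by rewrite ger0_norm ?subr_ge0 ?derivator_nd//; exact: (uL P).
  rewrite product_increment (le_trans (rnormD _ _))// !rnormM.
  have h1 : rnorm (beta x - beta t) * rnorm (u x) <= e / 4.
    rewrite (le_trans (ler_pM (rnorm_ge0 _) (rnorm_ge0 _) b1 ux))//.
    by rewrite invfM mulrA mulfVK// gt_eqF.
  have h2 : rnorm (beta t) * rnorm (u x - u t) <= e / 4.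
    have Q0 : 0 <= B * B * M by rewrite !mulr_ge0// ltW.
    apply: (@le_trans _ _ (B * B * M * `|g x - g t|)).
      by rewrite -mulrA -mulrA ler_pM ?rnorm_ge0 ?betaB// mulrA.
    apply: (@le_trans _ _ ((B * B * M + 1) * (e / (4 * (B * B * M + 1))))).
      by rewrite ler_pM// lerDl.
    rewrite mulrC invfM mulrA mulfVK//.
    by rewrite gt_eqF// ltr_wpDl.
  by lra.
have [Dt|Dt] := pselect (Dg g t); apply/rderP => e e0.
  pose k := 2 * B * M + 1.
  have k0 : 0 < k by rewrite /k ltr_wpDl// !mulr_ge0// ltW.
  have [d d0 dP] := derivator_right g t (divr_gt0 (mulr_gt0 e0 Dt) k0).
  exists d => // s /andP[s0 sT] _ sd /(_ Dt) ts _.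
  (* This is [2 B M g] beside [t], but at [t] it has the value from the right:
     the jump costs nothing. *)
  pose G x := 2 * B * M * Num.max (g x) (g t + jump g t).
  have Gr x : t < x -> G x = 2 * B * M * g x.
    by move=> /(jump_le g); rewrite /G lerBrDl => /max_idPl ->.
  have Gt : G t = 2 * B * M * (g t + jump g t).
    by rewrite /G max_r// lerDl ltW.
  have jts := jump_le g ts.
  rewrite ger0_norm ?subr_ge0 ?derivator_nd ?ltW//.
  apply: (@lt_le_trans _ _ (e * jump g t)); last by rewrite ler_pM2l.
  apply: (@le_lt_trans _ _ (G s - G t)); last first.
    rewrite Gr// Gt -mulrBr opprD addrA.
    apply: (@le_lt_trans _ _ (2 * B * M * (e * jump g t / k))).
      rewrite ler_wpM2l ?mulr_ge0// ?(ltW M0)// lerBlDl.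
      by rewrite ltW// dP.
    by rewrite mulrA ltr_pdivrMr// mulrC ltr_pM2l ?mulr_gt0// /k ltrDl.
  apply: (vP t s t (beta t) G) => //; first exact: ltW.
  move=> P u uP P0 _ sP tP x y xP; rewrite le_eqVlt => /predU1P[<-|tx] xy ys.
    rewrite subrr rnorm0 mul0r Gr// Gt -mulrBr mulr_ge0 ?mulr_ge0 ?(ltW M0)//.
    by have := jump_le g xy; lra.
  rewrite (Gr y (lt_trans tx xy)) (Gr x tx) -mulrBr.
  rewrite ler_wpM2r ?subr_ge0 ?derivator_nd ?(ltW xy)//.
  have xT : 0 <= x <= T.
    by rewrite (le_trans t0) ?(ltW tx)//= (le_trans (ltW xy)) ?(le_trans ys).
  rewrite (le_trans (rnormB _ _))// !rnormM -mulrA mulr2n mulrDl mul1r.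
  by rewrite lerD// ler_pM ?rnorm_ge0 ?betaB ?(uM P).
have eM : 0 < e / (4 * M) by rewrite divr_gt0// mulr_gt0.
have Q0 : 0 < B * B * M + 1 by rewrite ltr_wpDl// !mulr_ge0// ltW.
have eQ : 0 < e / (4 * (B * B * M + 1)) by rewrite divr_gt0// mulr_gt0.
have [bl br] := betaC t tT Ct Dt.
have [dl dl0 dlP] : exists2 d, 0 < d & forall s, 0 <= s <= T -> t - d < s ->
    s < t -> g s != g t ->
    rnorm (v s - v t - beta t * v t * rl (g s - g t)) < e * `|g s - g t|.
  have [lt|] := pselect (left_increasing g t); last first.
    move=> /existsNP[r /not_implyP[rt /negP]]; rewrite -leNgt => gtr.
    exists (t - r); first by rewrite subr_gt0.
    move=> s _ rs st /eqP[]; apply/le_anti; rewrite derivator_nd ?(ltW st)//=.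
    by rewrite (le_trans gtr)// derivator_nd//; lra.
  have /cvg_rnormP/(_ _ eM)/lfilterP[d1 d10 d1P] := bl lt.
  have [d2 d20 d2P] := derivator_left g t eQ.
  exists (Num.min d1 d2); first by rewrite lt_min d10.
  move=> s /andP[s0 sT] ds st gst.
  have {ds}[ds1 ds2] : t - d1 < s /\ t - d2 < s.
    by move: ds; rewrite ltrBlDr -ltrBlDl lt_min => /andP[]; lra.
  have gst0 : 0 < g t - g s by rewrite subr_gt0 lt.
  have -> : v s - v t - beta t * v t * rl (g s - g t) =
      - (v t - v s - beta t * v t * rl (g t - g s)).
    rewrite -[g s - g t]opprB rmorphN mulrN.
    by rewrite opprB opprB [RHS]addrC opprK addrC.
  rewrite rnormN distrC (ger0_norm (ltW gst0)).
  apply: (@le_lt_trans _ _ (e / 2 * (g t - g s))); last first.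
    by rewrite ltr_pM2r// ltr_pdivrMr// ltr_pMr// ltr1n.
  apply: near_estimate => //; first exact: ltW.
  move=> x sx xt; split.
    apply/ltW/d1P => //; last exact: lt_le_trans sx.
    by rewrite (le_trans s0)//= (le_trans (ltW xt)).
  rewrite distrC ger0_norm ?subr_ge0 ?derivator_nd ?ltW//.
  by apply: d2P; rewrite ?(lt_le_trans ds2)// ltW.
have [dr dr0 drP] : exists2 d, 0 < d & forall s, 0 <= s <= T -> t < s ->
    s < t + d -> g s != g t ->
    rnorm (v s - v t - beta t * v t * rl (g s - g t)) < e * `|g s - g t|.
  have [rt|] := pselect (right_increasing g t); last first.
    move=> /existsNP[r /not_implyP[tr /negP]]; rewrite -leNgt => grt.
    exists (r - t); first by rewrite subr_gt0.
    move=> s _ ts sr /eqP[]; apply/le_anti.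
    rewrite (@derivator_nd _ g t) ?(ltW ts)// andbT.
    by rewrite (le_trans _ grt)// derivator_nd//; lra.
  have /cvg_rnormP/(_ _ eM)/rfilterP[d1 d10 d1P] := br rt.
  have [d2 d20 d2P] := derivator_right g t eQ.
  exists (Num.min d1 d2); first by rewrite lt_min d10.
  move=> s /andP[s0 sT] ts.
  rewrite -ltrBlDl lt_min !ltrBlDl => /andP[sd1 sd2] gst.
  have gst0 : 0 < g s - g t by rewrite subr_gt0 rt.
  rewrite (ger0_norm (ltW gst0)).
  apply: (@le_lt_trans _ _ (e / 2 * (g s - g t))); last first.
    by rewrite ltr_pM2r// ltr_pdivrMr// ltr_pMr// ltr1n.
  apply: near_estimate => //; first exact: ltW.
  move=> x; rewrite le_eqVlt => /predU1P[<- _|tx xs].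
    by rewrite !subrr rnorm0 normr0 !ltW.
  split.
    apply/ltW/d1P => //; last exact: lt_trans xs _.
    by rewrite (le_trans t0) ?(ltW tx)//= (le_trans (ltW xs)).
  rewrite ger0_norm ?subr_ge0 ?derivator_nd ?ltW//.
  have := d2P x tx (lt_trans xs sd2); rewrite jump_eq0// add0r => //.
exists (Num.min dl dr); first by rewrite lt_min dl0.
move=> s sT ds; rewrite -ltrBlDl lt_min => /andP[_ sd] _ gst.
have [st|ts|st] := ltgtP s t; last by rewrite st eqxx in gst.
- apply: dlP => //; move: ds.
  by rewrite ltrBlDr -ltrBlDl lt_min => /andP[]; lra.
- by apply: drP => //; rewrite -ltrBlDl.
Qed.

End exponential_derivative.

(** * Null sets of the Stieltjes measure *)

Section negligible_sets.
Context {R : realType}.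
Variable g : derivator R.
Local Notation mu := (mu_g g).

(** [C] is reflected, as in the definition of [mu_g]. Left continuity of [g]
    allows the enlargement of a half-open interval to an open one at a small
    cost. *)
Lemma ocitv_open_cover (C : set R) (e : R) : ocitv C -> 0 < e ->
  exists V : set R, [/\ open V, forall x, C (- x) -> V x &
    (mu V <= wlength (reflect_derivator g) C + e%:E)%E].
Proof.
move=> /ocitvP[->|[[a b] /= ab ->]] e0.
  exists set0; split; [exact: open0|by []|].
  by rewrite measure0 wlength0 add0e lee_fin ltW.
have [d d0 dP] := derivator_left g (- b) e0.
pose c := - b - d / 2.
have cb : c < - b by rewrite /c; lra.
have ca : c < - a by rewrite (lt_trans cb)// ltrN2.
exists `]c, (- a)[%classic; split.
- exact: itv_open.
- by move=> x /=; rewrite !in_itv/= => /andP[ax xb]; lra.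
- apply: (@le_trans _ _ (mu `[c, (- a)[%classic)).
    apply: le_measure; rewrite ?inE; [exact: measurable_itv..|].
    by move=> x /=; rewrite !in_itv/= => /andP[/ltW -> ->].
  rewrite [leLHS]mu_g_itv ?(ltW ca)// wlength_itv_bnd ?(ltW ab)//.
  rewrite -EFinD lee_fin /reflect_derivator.
  have : g (- b) - g c < e by apply: dP; rewrite ?(ltW cb)// /c; lra.
  by lra.
Qed.

(** The measure is by construction the outer measure of covers by half-open
    intervals. *)
Lemma negligible_open_cover (E : set R) (e : R) : mu.-negligible E -> 0 < e ->
  exists U : set R, [/\ open U, E `<=` U & (mu U < e%:E)%E].
Proof.
move=> [A [mA muA EA]] e0; have e2 : 0 < e / 2 by rewrite divr_gt0.
pose nu := wlength (reflect_derivator g).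
have inf0 : mu_ext nu (-%R @^-1` A) = 0%E by exact: muA.
have : mu_ext nu (-%R @^-1` A) \is a fin_num by rewrite inf0.
move=> /(lb_ereal_inf_adherent e2)[_ [C [mC AC] <-]].
rewrite -/(mu_ext _ _) inf0 add0e => sumC.
have e4 i : 0 < e / 2 / (2 ^ i.+1)%:R.
  by rewrite divr_gt0// ltr0n expn_gt0.
have /choice[V VP] i := ocitv_open_cover (mC i) (e4 i).
exists (\bigcup_i V i); split.
- by apply: bigcup_open => i _; have [] := VP i.
- move=> x /EA Ax; have [|i _ Ci] := AC (- x); first by rewrite /= opprK.
  by exists i => //; have [_ + _] := VP i; apply.
have mV i : measurable (V i : set (measurableTypeR R)).
  by have [+ _ _] := VP i; exact: measurable_realfun.open_measurable.
apply: (@le_lt_trans _ _ (\sum_(0 <= i <oo) mu (V i))%E).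
  by apply: measure_sigma_subadditive => //; exact: bigcup_measurable.
apply: (@le_lt_trans _ _
    (\sum_(0 <= i <oo) (nu (C i) + (e / 2 / (2 ^ i.+1)%:R)%:E))%E).
  by apply: lee_nneseries => i _ //; have [] := VP i.
apply: (@le_lt_trans _ _ (\sum_(0 <= i <oo) nu (C i) + (e / 2)%:E)%E).
  by apply: epsilon_trick => [i|]; [exact: wlength_ge0|exact: ltW].
by rewrite [in ltRHS](splitr e) EFinD lteD2rE.
Qed.

(** Around each of its points, [Cg] contains an interval with rational endpoints
    on which [g] is constant. *)
Lemma negligible_Cg : mu.-negligible (Cg g).
Proof.
pose F (n : nat) : set R :=
  if @unpickle (rat * rat)%type n is Some (p, q) then
    if (ratr p < (ratr q : R)) && (g (ratr p) == g (ratr q))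
    then `[ratr p, ratr q[%classic else set0
  else set0.
apply: (@negligibleS _ (measurableTypeR R) R mu (\bigcup_n F n) (Cg g)).
  move=> t Ct; have [e e0 te] := Ct.
  have [p] := @rat_in_itvoo R (t - e) t ltac:(lra).
  have [q] := @rat_in_itvoo R t (t + e) ltac:(lra).
  rewrite !in_itv/= => /andP[tq qe] /andP[ep pt].
  have pq : ratr p < (ratr q : R) by exact: lt_trans pt tq.
  have gpq : g (ratr p) = g (ratr q).
    by rewrite (te (ratr p)) ?(te (ratr q)); lra.
  exists (pickle (p, q)); first exact: I.
  by rewrite /F pickleK pq gpq eqxx /= in_itv/= (ltW pt).
apply: (@negligible_bigcup _ (measurableTypeR R) R mu F) => n; rewrite /F.
case: unpickle => [[p q]|]; last exact: negligible_set0.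
case: ifP => [/andP[pq /eqP gpq]|_]; last exact: negligible_set0.
exists `[ratr p, ratr q[%classic; split => //.
by rewrite [LHS]mu_g_itv ?(ltW pq)// gpq subrr.
Qed.

Lemma not_negligible_itv (x y : R) : g x < g y ->
  ~ mu.-negligible `[x, y[%classic.
Proof.
move=> gxy; have xy : x <= y.
  by rewrite leNgt; apply/negP => /ltW/(derivator_nd g); lra.
rewrite /negligible => -[A [mA muA xyA]].
have : (mu `[x, y[%classic <= mu A)%E.
  by apply: le_measure; rewrite ?inE//; exact: measurable_itv.
by rewrite muA [leLHS]mu_g_itv// lee_fin; lra.
Qed.

End negligible_sets.

(** * Absolutely continuous functions *)

Section interval_chains.
Context {R : realType}.
Implicit Types (L : seq (R * R)) (u v w : R).

(** With the disjoint intervals of [W11] listed from left to right, families in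
    adjacent segments are joined by concatenation. *)
Fixpoint chain u L v : bool :=
  if L is i :: L' then [&& u <= i.1, i.1 < i.2 & chain i.2 L' v] else u <= v.

Lemma chain_le u L v : chain u L v -> u <= v.
Proof.
elim: L u => [//|i L IH] u /= /and3P[ui ii /IH iv].
by rewrite (le_trans ui)// (le_trans (ltW ii)).
Qed.

Lemma chain_wdl u u' L v : u' <= u -> chain u L v -> chain u' L v.
Proof.
case: L => [|i L] /= u'u; first exact: le_trans.
by case/and3P=> /(le_trans u'u) -> -> ->.
Qed.

Lemma chain_cat u L v L' w : chain u L v -> chain v L' w -> chain u (L ++ L') w.
Proof.
elim: L u => [|i L IH] u /=; first exact: chain_wdl.
by move=> /and3P[-> -> /IH h] /h.
Qed.

Lemma chain_nth u L v d j : chain u L v -> (j < size L)%N ->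
  [/\ u <= (nth d L j).1, (nth d L j).1 < (nth d L j).2 & (nth d L j).2 <= v].
Proof.
elim: L u j => [//|i L IH] u [|j] /= /and3P[ui ii iL] jL.
  by split=> //; exact: chain_le iL.
have [h1 h2 h3] := IH _ _ iL jL; split=> //.
by rewrite (le_trans ui)// (le_trans (ltW ii)).
Qed.

Lemma chain_ltn u L v d j k : chain u L v -> (j < k)%N -> (k < size L)%N ->
  (nth d L j).2 <= (nth d L k).1.
Proof.
elim: L u j k => [//|i L IH] u j [//|k] /= /and3P[ui ii iL] jk kL.
case: j jk => [|j] jk /=; first by have [] := chain_nth d iL kL.
exact: (IH i.2 j k iL jk kL).
Qed.

End interval_chains.

Section absolutely_continuous.
Context {R : realType} {F : scalars}.
Variables (g : derivator R) (T : R).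
Hypotheses (T_gt0 : 0 < T).
Local Notation K := (scalar_field R F).
Implicit Types (f h : R -> K).

Fact sum_normE n (k : 'I_n -> K) :
  \sum_(j < n) `|k j| = of_real F (\sum_(j < n) rnorm (k j)).
Proof. by rewrite rmorph_sum; apply: eq_bigr => j _; rewrite normE. Qed.

Lemma W11_chain f : W11 g T f -> forall e : R, 0 < e -> exists2 d : R, 0 < d &
  forall L, chain 0 L T -> \sum_(i <- L) (g i.2 - g i.1) < d ->
  \sum_(i <- L) rnorm (f i.2 - f i.1) < e.
Proof.
move=> fW e /(pos_of_real (F := F))/fW[d d0 dP]; exists d => // L cL.
rewrite !(big_nth (0, 0)) !big_mkord => sumL.
rewrite -(@ltr_of_real R F) -sum_normE.
pose L_ j := nth ((0 : R), (0 : R)) L j.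
apply: (dP (size L) (fun j => (L_ j).1) (fun j => (L_ j).2)) => //.
  by move=> j; exact: (chain_nth _ cL (ltn_ord j)).
have disj j k x : (j < k)%N -> (k < size L)%N ->
    x < (L_ j).2 -> (L_ k).1 < x -> False.
  by move=> jk kL xj /(lt_trans)/(_ xj); rewrite ltNge (chain_ltn _ cL jk kL).
move=> j k _ _ [x []] /=; rewrite !in_itv/= => /andP[jx xj] /andP[kx xk].
have [jk|kj|/val_inj//] := ltngtP (val j) (val k).
  by case: (disj _ _ _ jk (ltn_ord k) xj kx).
by case: (disj _ _ _ kj (ltn_ord j) xk jx).
Qed.

Lemma W11_dist f : W11 g T f -> forall e : R, 0 < e -> exists2 d : R, 0 < d &
  forall u v, 0 <= u -> u <= v -> v <= T -> g v - g u < d ->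
  rnorm (f v - f u) < e.
Proof.
move=> /W11_chain fW e e0; have [d d0 dP] := fW e e0; exists d => // u v u0.
rewrite le_eqVlt => /predU1P[-> *|uv vT guv]; first by rewrite subrr rnorm0.
by have := dP [:: (u, v)]; rewrite !big_seq1/= u0 uv vT; apply.
Qed.

Lemma W11_flat f u v : W11 g T f -> 0 <= u -> u <= v -> v <= T -> g u = g v ->
  f u = f v.
Proof.
move=> /W11_dist fW u0 uv vT guv.
apply/eqP; rewrite eq_sym -subr_eq0 -rnorm_eq0.
rewrite eq_le rnorm_ge0 andbT; apply/ler_addgt0Pr => e /fW[d d0 dP].
by rewrite add0r ltW// dP// guv subrr.
Qed.

(** Close to a point, [g] varies little on the left side, and little on the
    right side apart from the jump; hence so does [f]. *)
Lemma W11_bounded f : W11 g T f -> bounded_on_segment T f.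
Proof.
move=> /W11_dist/(_ _ ltr01)[d d0 dP].
pose P u v := exists M, forall s, u <= s <= v -> rnorm (f s) <= M.
apply: (@local_to_global R P 0 T) => //; first exact: ltW.
- move=> x; exists (rnorm (f x)) => s xsx.
  by have -> : s = x by apply/le_anti; rewrite andbC.
- move=> x y z _ xy yz _ [M1 H1] [M2 H2].
  exists (Num.max M1 M2) => s /andP[xs sz].
  rewrite le_max; have [sy|ys] := leP s y; first by rewrite H1 ?xs.
  by rewrite H2 ?orbT// ltW.
move=> x /andP[x0 xT].
have [d1 d10 d1P] := derivator_left g x d0.
have [d2 d20 d2P] := derivator_right g x d0.
exists (Num.min d1 d2); first by rewrite lt_min d10.
move=> u v u0 ux xv vT; set m := Num.min _ _ => mu mv _.
have [m1 m2] : m <= d1 /\ m <= d2 by rewrite /m !ge_min !lexx orbT.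
exists (Num.max (rnorm (f x) + 1) (rnorm (f v) + 1)) => s /andP[us sv].
rewrite le_max; have [sx|xs] := leP s x.
  have fsx : rnorm (f x - f s) < 1.
    by apply: dP; rewrite ?(le_trans u0)//; apply: d1P => //; lra.
  apply/orP; left; rewrite addrC -(subrK (f x) (f s)) (le_trans (rnormD _ _))//.
  by rewrite lerD2r rnorm_distC ltW.
have fvs : rnorm (f v - f s) < 1.
  apply: dP => //; first by rewrite (le_trans x0)// ltW.
  have h1 := jump_le g xs.
  by have := d2P v (lt_le_trans xs sv) ltac:(lra); lra.
apply/orP; right; rewrite addrC -(subrK (f v) (f s)) (le_trans (rnormD _ _))//.
by rewrite lerD2r rnorm_distC ltW.
Qed.

Lemma W11M f h : W11 g T f -> W11 g T h -> W11 g T (fun t => f t * h t).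
Proof.
move=> fW hW.
have pos_bound k : bounded_on_segment T k -> exists2 M : R, 0 < M &
    forall t, 0 <= t <= T -> rnorm (k t : K) <= M.
  move=> [M kM].
  exists (Num.max 1 M) => [|t /kM]; first by rewrite lt_max ltr01.
  by rewrite le_max => ->; rewrite orbT.
have [M M0 fM] := pos_bound _ (W11_bounded fW).
have [N N0 hN] := pos_bound _ (W11_bounded hW).
move=> e /pos_of_realP[e' e'0 ->].
have eN : 0 < of_real F (e' / (2 * N)).
  by rewrite pos_of_real// divr_gt0// mulr_gt0.
have eM : 0 < of_real F (e' / (2 * M)).
  by rewrite pos_of_real// divr_gt0// mulr_gt0.
have [d1 d10 d1P] := fW _ eN; have [d2 d20 d2P] := hW _ eM.
exists (Num.min d1 d2); first by rewrite lt_min d10.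
move=> n a b ab dis; rewrite lt_min => /andP[s1 s2].
have := d1P n a b ab dis s1; have := d2P n a b ab dis s2.
rewrite !sum_normE !ltr_of_real !ltr_pdivlMr ?mulr_gt0// => h2 h1.
apply: (@le_lt_trans _ _ (\sum_(j < n) (N * rnorm (f (b j) - f (a j)) +
    M * rnorm (h (b j) - h (a j))))); last first.
  by rewrite big_split/= -!mulr_sumr; nra.
apply: ler_sum => j _; rewrite product_increment (le_trans (rnormD _ _))//.
have [aj abj bj] := ab j.
rewrite !rnormM mulrC lerD// ler_wpM2r ?rnorm_ge0//.
  by rewrite hN// bj (le_trans aj) ?ltW.
by rewrite fM// aj (le_trans _ bj) ?ltW.
Qed.

End absolutely_continuous.

(** * Functions with vanishing derivative *)

Section zero_derivative.
Context {R : realType} {F : scalars}.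
Variables (g : derivator R) (T : R).
Local Notation K := (scalar_field R F).
Local Notation mu := (mu_g g).
Implicit Types (f h : R -> K).

(** Cover [E] by an open set [U] of small measure and choose a fine partition
    with a tag in each of its intervals. Where the tag is in [E], the interval
    lies in [U], and absolute continuity bounds the sum of these increments of
    [f]. Where the tag is in [Cg], [f] does not vary; at the other tags the
    zero derivative makes the increment of [f] a small part of that of [g]. At
    a jump this concerns the part on the right of the tag; the part on the left
    is made small in comparison with the jump. *)
Lemma W11_constant f (E : set R) : W11 g T f -> mu.-negligible E ->
  (forall t, 0 <= t < T -> ~ Cg g t -> ~ E t -> rder g T f t 0) ->
  forall t, 0 <= t <= T -> f t = f 0.
Proof.
move=> fW E0 f0 t /andP[t0 tT].
suff H e : 0 < e -> rnorm (f t - f 0) < e + e * (g t + 1 - g 0).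
  apply/eqP; rewrite -subr_eq0 -rnorm_eq0 eq_le rnorm_ge0 andbT.
  apply/ler_addgt0Pr => e e0; rewrite add0r.
  have c0 : 0 < 2 + (g t - g 0) by rewrite ltr_wpDr// subr_ge0 derivator_nd.
  apply: le_trans (ltW (H (e / (2 + (g t - g 0))) _)) _; first exact: divr_gt0.
  rewrite le_eqVlt; apply/orP; left; apply/eqP.
  by field; rewrite gt_eqF.
move=> e0; have [d d0 dP] := W11_chain fW e0.
have [U [oU EU muU]] := negligible_open_cover E0 d0.
have mU : measurable (U : set (measurableTypeR R)).
  exact: measurable_realfun.open_measurable.
(* The increments of this monotone function bound the lengths of the intervals
   inside [U], and they add up when partitions are concatenated. *)
pose m x := fine (mu (U `&` `[0, x[%classic)).
have mI (x y : R) :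
    measurable (U `&` `[x, y[%classic : set (measurableTypeR R)).
  by apply: measurableI => //; exact: measurable_itv.
have finI x y : mu (U `&` `[x, y[%classic) \is a fin_num.
  rewrite ge0_fin_numE//; apply: (@le_lt_trans _ _ (mu U)).
    by apply: le_measure; rewrite ?inE//; apply: subIsetl.
  by rewrite (lt_trans muU)// ltry.
have mD u v : 0 <= u -> u <= v ->
    m v = m u + fine (mu (U `&` `[u, v[%classic)).
  move=> u0 uv; rewrite /m -fineD//; congr fine.
  rewrite -measureU//.
    congr (mu _); rewrite -setIUr; congr (_ `&` _); apply/seteqP; split => x /=.
      rewrite !in_itv/= => /andP[x0 xv].
      by have [xu|ux] := ltP x u; [left; rewrite x0|right].
    by rewrite !in_itv/= => -[] /andP[h1 h2]; lra.
  rewrite setIACA setIid -subset0 => x [_ []] /=.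
  by rewrite !in_itv/= => h1 h2; lra.
have m_le u v : 0 <= u -> u <= v -> m u <= m v.
  by move=> u0 uv; rewrite (mD u v)// lerDl fine_ge0.
have mT : m t - m 0 < d.
  have -> : m 0 = 0.
    by rewrite /m set_itv_ge -?leNgt ?bnd_simp// setI0 measure0.
  rewrite subr0 /m -lte_fin fineK//; apply: le_lt_trans muU.
  by apply: le_measure; rewrite ?inE//; apply: subIsetl.
(* The endpoint [t] has its own allowance [e]: at a jump the derivative controls
   [f] on the right only, and at [T] it is not known. *)
pose G x := e * (g x + (t <= x)%R%:R).
have G_le u v : u <= v -> e * (g v - g u) <= G v - G u.
  move=> uv; rewrite -mulrBr ler_pM2l// opprD addrACA lerDl subr_ge0.
  rewrite ler_nat; have [tu|] := leP t u; last by [].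
  by rewrite (le_trans tu uv).
pose P u v := exists L, [/\ chain u L v,
  \sum_(i <- L) (g i.2 - g i.1) <= m v - m u &
  rnorm (f v - f u) <= \sum_(i <- L) rnorm (f i.2 - f i.1) + (G v - G u)].
have P_nil u v : 0 <= u -> u <= v -> rnorm (f v - f u) <= G v - G u -> P u v.
  move=> u0 uv fuv; exists [::]; rewrite !big_nil add0r; split => //.
  by rewrite subr_ge0 m_le.
suff [L [cL gL fL]] : P 0 t.
  have cLT : chain 0 L T.
    by rewrite -[L]cats0; apply: chain_cat cL _.
  have := dP L cLT (le_lt_trans gL mT).
  have G0t : G t - G 0 <= e * (g t + 1 - g 0).
    rewrite /G -mulrBr ler_pM2l// lexx lerD2l lerN2 lerDl.
    exact: ler0n.
  by lra.
apply: local_to_global => //.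
- move=> x; exists [::]; rewrite !big_nil /= !subrr rnorm0 addr0.
  by split; rewrite ?lexx.
- move=> x y z x0 xy yz zt [L [cL gL fL]] [L' [cL' gL' fL']].
  exists (L ++ L'); split; first exact: chain_cat cL cL'.
    by rewrite big_cat/=; lra.
  rewrite big_cat/= -(subrKA (f y) (f z)) (le_trans (rnormD _ _))//.
  by lra.
move=> x /andP[x0 xt].
have [d1 d10 d1P] := W11_dist fW e0.
have [xltt|tx] := ltP x t; last first.
  have {x0 xt tx}-> : x = t by apply/le_anti; rewrite xt.
  have [d2 d20 d2P] := derivator_left g t d10.
  exists d2 => // u v u0 ut tv vt du _ _.
  have {tv vt}-> : v = t by apply/le_anti; rewrite vt.
  apply: P_nil => //; move: ut; rewrite le_eqVlt => /predU1P[->|ut].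
    by rewrite !subrr rnorm0.
  apply: (@le_trans _ _ e).
    by apply/ltW/d1P; rewrite ?(ltW ut)//; apply: d2P => //; exact: ltW.
  rewrite /G lexx (leNgt t u) ut/= addr0 -mulrBr -addrA addrCA.
  by rewrite ler_peMr ?(ltW e0)// lerDl subr_ge0 derivator_nd// ltW.
have [Cx|Cx] := pselect (Cg g x).
  have [c c0 xc] := Cx; exists c => // u v u0 ux xv vt cu vc _.
  apply: P_nil => //; first exact: le_trans ux xv.
  rewrite (W11_flat fW u0 (le_trans ux xv)) ?(le_trans vt)//.
    rewrite subrr rnorm0 (le_trans _ (G_le _ _ (le_trans ux xv)))//.
    by rewrite mulr_ge0 ?(ltW e0)// subr_ge0 derivator_nd// (le_trans ux).
  by rewrite (xc u) ?(xc v)//; lra.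
have [Ex|Ex] := pselect (E x).
  have /nbhs_ballP[c /= c0 xcU] : nbhs x U.
    by apply: open_nbhs_nbhs; split => //; exact: EU.
  exists c => // u v u0 ux xv vt cu vc xvt.
  have uv : u < v by rewrite (le_lt_trans ux)//; case: xvt => // xE; lra.
  exists [:: (u, v)]; rewrite !big_seq1/= lexx uv lexx; split=> //.
    rewrite (mD u v) ?(ltW uv)// addrAC subrr add0r.
    rewrite (_ : U `&` _ = `[u, v[%classic).
      by rewrite [mu _]mu_g_itv// ltW.
    apply/setIidr => y /=; rewrite in_itv/= => /andP[uy yv]; apply: xcU.
    by rewrite /ball/= ltr_distlC; lra.
  rewrite lerDl (le_trans _ (G_le _ _ (ltW uv)))//.
  by rewrite mulr_ge0 ?(ltW e0)// subr_ge0 derivator_nd// ltW.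
have e2 : 0 < e / 2 by rewrite divr_gt0.
have /rderP/(_ _ e2)[c c0 cP] : rder g T f x 0.
  by apply: f0 => //; rewrite x0 (lt_le_trans xltt).
have near_x s : 0 <= s -> s <= T -> x - c < s -> s < x + c ->
    (Dg g x -> x < s) -> rnorm (f s - f x) <= e / 2 * `|g s - g x|.
  move=> s0 sT cs sc Ds; have [gsx|gsx] := eqVneq (g s) (g x).
    suff -> : f s = f x by rewrite subrr rnorm0 mulr_ge0// ltW.
    have [sx|/ltW xs] := leP s x; last first.
      by apply/esym; apply: (W11_flat fW) => //; exact: esym.
    by apply: (W11_flat fW) => //; exact: le_trans xt tT.
  by have := cP s _ cs sc Ds gsx; rewrite s0 sT mul0r subr0 => /(_ isT)/ltW.
have [Dx|Dx] := pselect (Dg g x); last first.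
  exists c => // u v u0 ux xv vt cu vc _.
  apply: P_nil => //; first exact: le_trans xv.
  apply: le_trans (G_le _ _ (le_trans ux xv)).
  apply: le_trans (rnorm_dist_tri (f x) _ _) _.
  have xT : x <= T by exact: le_trans xt tT.
  have h1 : rnorm (f v - f x) <= e / 2 * `|g v - g x|.
    by apply: near_x => //; [exact: le_trans xv|exact: le_trans tT|lra].
  have h2 : rnorm (f u - f x) <= e / 2 * `|g u - g x|.
    by apply: near_x => //; [exact: le_trans xT|lra].
  rewrite rnorm_distC in h2.
  have gux := derivator_nd g ux; have gxv := derivator_nd g xv.
  rewrite ger0_norm ?subr_ge0// in h1.
  rewrite distrC ger0_norm ?subr_ge0// in h2.
  by nra.
have [d2 d20 d2P] := W11_dist fW (mulr_gt0 e2 Dx).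
have [d3 d30 d3P] := derivator_left g x d20.
exists (Num.min c d3); first by rewrite lt_min c0.
move=> u v u0 ux xv vt; set a := Num.min c d3 => au va.
have [ac a3] : a <= c /\ a <= d3 by rewrite /a !ge_min !lexx orbT.
case=> [xltv|xE]; last by rewrite xE ltxx in xltt.
apply: P_nil => //; first exact: le_trans xv.
apply: le_trans (G_le _ _ (le_trans ux xv)).
apply: le_trans (rnorm_dist_tri (f x) _ _) _.
have h1 : rnorm (f v - f x) <= e / 2 * `|g v - g x|.
  by apply: near_x => //; [exact: le_trans xv|exact: le_trans tT|lra|lra].
have h2 : rnorm (f x - f u) < e / 2 * jump g x.
  by apply: d2P => //; [lra|apply: d3P => //; lra].
have gux := derivator_nd g ux; have gxv := derivator_nd g xv.
have jxv := jump_le g xltv.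
rewrite ger0_norm ?subr_ge0// in h1.
by nra.
Qed.

End zero_derivative.

(** * The adjoint coefficient *)

Fact adjoint_cancel (K : fieldType) (b j u z : K) : 1 + b * j != 0 ->
  b * u * z + u * (- b / (1 + b * j) * z) +
    b * u * (- b / (1 + b * j) * z) * j = 0.
Proof. by move=> bj0; field. Qed.

Section adjoint.
Context {R : realType} {F : scalars}.
Variables (g : derivator R) (T : R).
Hypotheses (T_gt0 : 0 < T).
Local Notation K := (scalar_field R F).
Local Notation rl := (of_real F).

Lemma jump_small x e : 0 < e ->
  exists2 d, 0 < d & forall s, x - d < s -> s < x + d -> s != x -> jump g s < e.
Proof.
move=> e0; have [d1 d10 d1P] := derivator_left g x e0.
have [d2 d20 d2P] := derivator_right g x e0.
exists (Num.min d1 d2); first by rewrite lt_min d10.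
move=> s; set d := Num.min _ _ => ds sd.
have [dd1 dd2] : d <= d1 /\ d <= d2 by rewrite /d !ge_min !lexx orbT.
have [sx|xs|//] := ltgtP s x.
  move=> _; apply: le_lt_trans (jump_le g sx) _.
  by apply: d1P; [lra|exact: ltW].
move=> _; pose y := (s + (x + d)) / 2.
have [sy yx] : s < y /\ y < x + d by rewrite /y; lra.
have h1 := jump_le g sy; have h2 := jump_le g xs.
by have := d2P y (lt_trans xs sy) ltac:(lra); lra.
Qed.

(** The coefficient of the equation solved by the inverse of the exponential. *)
Definition adjoint (beta : R -> K) t : K :=
  - beta t / (1 + beta t * rl (jump g t)).

Lemma regressive_neq0 beta t : gregressive g T beta -> 0 <= t <= T ->
  1 + beta t * rl (jump g t) != 0.
Proof.
move=> reg tT; have [/reg|/jump_eq0 ->] := pselect (Dg g t); first exact.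
by rewrite rmorph0 mulr0 addr0 oner_neq0.
Qed.

(** Jumps are small near every point other than the point itself, so that
    pointwise regressivity suffices, by compactness of [[0, T]]. *)
Lemma regressive_bound beta :
  bounded_on_segment T beta -> gregressive g T beta ->
  exists2 c : R, 0 < c &
    forall t, 0 <= t <= T -> c <= rnorm (1 + beta t * rl (jump g t)).
Proof.
move=> [B' betaB'] reg; pose B := Num.max 1 B'.
have B0 : 0 < B by rewrite lt_max ltr01.
have betaB t : 0 <= t <= T -> rnorm (beta t) <= B.
  by move=> /betaB' h; rewrite le_max h orbT.
pose P u v := exists2 c : R, 0 < c & forall t, 0 <= t <= T -> u <= t <= v ->
  c <= rnorm (1 + beta t * rl (jump g t)).
suff [c c0 cP] : P 0 T by exists c => // t tT; exact: cP.
have pos x : 0 <= x <= T -> 0 < rnorm (1 + beta x * rl (jump g x)).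
  by move=> xT; rewrite lt_neqAle rnorm_ge0 eq_sym rnorm_eq0 regressive_neq0.
apply: local_to_global; first exact: ltW.
- move=> x; have [xT|xT] := boolP (0 <= x <= T).
    exists (rnorm (1 + beta x * rl (jump g x))); first exact: pos.
    by move=> t _ xtx; have -> : t = x by apply/le_anti; rewrite andbC.
  exists 1 => // t tT xtx; have tx : t = x by apply/le_anti; rewrite andbC.
  by rewrite tx (negPf xT) in tT.
- move=> x y z _ xy yz _ [c1 c10 c1P] [c2 c20 c2P].
  exists (Num.min c1 c2); first by rewrite lt_min c10.
  move=> t tT /andP[xt tz]; rewrite ge_min.
  have [ty|yt] := leP t y; first by rewrite c1P ?xt.
  by rewrite c2P ?orbT// ltW.
move=> x xT; have B2 : 0 < (2 * B)^-1 by rewrite invr_gt0 mulr_gt0.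
have [d d0 dP] := jump_small x B2.
exists d => // u v u0 ux xv vT ud vd _.
exists (Num.min (1 / 2) (rnorm (1 + beta x * rl (jump g x)))).
  by rewrite lt_min pos// divr_gt0.
move=> t tT /andP[ut tv]; rewrite ge_min; have [->|tx] := eqVneq t x.
  by rewrite lexx orbT.
apply/orP; left.
have jt : jump g t < (2 * B)^-1 by apply: dP => //; lra.
have : rnorm (beta t * rl (jump g t)) <= 1 / 2.
  rewrite rnormM rnorm_of_real (ger0_norm (jump_ge0 _ _)).
  have := ler_pM (rnorm_ge0 _) (jump_ge0 _ _) (betaB t tT) (ltW jt).
  move=> /le_trans; apply.
  by rewrite invfM mulrA mulrAC divff ?gt_eqF// mul1r.
have := rnormB (1 + beta t * rl (jump g t)) (beta t * rl (jump g t)).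
by rewrite addrK rnorm1; lra.
Qed.

Lemma BD_adjoint beta : BD g T beta -> gregressive g T beta ->
  BD g T (adjoint beta).
Proof.
move=> /(BDP g T_gt0)[betab betac] reg; apply/(BDP g T_gt0); split.
  have [c c0 cP] := regressive_bound betab reg; have [B betaB] := betab.
  exists (B / c) => t tT; rewrite /adjoint rnormM rnormN rnormV.
  rewrite ler_pM ?rnorm_ge0 ?invr_ge0 ?rnorm_ge0 ?betaB//.
  by rewrite lef_pV2 ?posrE ?cP// (lt_le_trans c0) ?cP.
move=> t tT Ct Dt; have [bl br] := betac t tT Ct Dt.
have lim (G : set_system R) : Filter G -> jump g s @[s --> G] --> (0 : R) ->
    beta @ G --> beta t -> adjoint beta @ G --> adjoint beta t.
  move=> FG jG bG; rewrite /adjoint; apply: cvgM; first exact: cvgN.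
  apply: cvgV; first exact: regressive_neq0.
  apply: cvgD; first exact: cvg_cst.
  by apply: cvgM => //; apply: cvg_of_real; rewrite jump_eq0.
split=> [Lt|Rt].
  apply: lim (bl Lt); apply/cvgrPdist_lt => e e0; apply/lfilterP.
  have [d d0 dP] := jump_small t e0; exists d => // s sT ds st.
  rewrite sub0r normrN ger0_norm ?jump_ge0//; apply: dP => //; first by lra.
  by rewrite lt_eqF.
apply: lim (br Rt); apply/cvgrPdist_lt => e e0; apply/rfilterP.
have [d d0 dP] := jump_small t e0; exists d => // s sT ts sd.
rewrite sub0r normrN ger0_norm ?jump_ge0//; apply: dP => //; first by lra.
by rewrite gt_eqF.
Qed.

End adjoint.

(** * Solutions of the linear equation *)

Section vanishing.
Context {R : realType} {F : scalars}.
Variables (g : derivator R) (T : R).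
Hypotheses (T_gt0 : 0 < T) (Ngm_0 : ~ Ngm g 0)
  (T_notin : ~ (Ngp g `|` Dg g `|` Cg g) T).
Local Notation K := (scalar_field R F).

(** If [f t] is not [0], then [E] contains a set of positive measure: the point
    [t] itself when it is a jump, and otherwise an interval beside [t], by the
    continuity of [f] on a side on which [g] increases. *)
Lemma BD_ae_eq0 (f : R -> K) (E : set R) : BD g T f -> (mu_g g).-negligible E ->
  (forall t, 0 <= t < T -> ~ E t -> f t = 0) ->
  forall t, 0 <= t <= T -> ~ Cg g t -> f t = 0.
Proof.
move=> /(BDP g T_gt0)[_ fc] E0 f0 t tT Ct; have /andP[t0 t1] := tT.
apply: contrapT => /eqP ft0.
have memE s : 0 <= s < T -> f s != 0 -> E s.
  by move=> sT /eqP fs; apply: contrapT => /(f0 s sT).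
have [Dt|Dt] := pselect (Dg g t).
  have Et : E t by apply: memE => //; rewrite t0 (Dg_ltT T_notin).
  have [U [oU EU muU]] := negligible_open_cover E0 Dt.
  have /nbhs_ballP[c /= c0 tcU] : nbhs t U.
    by apply: open_nbhs_nbhs; split => //; exact: EU.
  have ttc : t < t + c by rewrite ltrDl.
  have : (mu_g g `[t, (t + c)%R[%classic <= mu_g g U)%E.
    apply: le_measure; rewrite ?inE; first exact: measurable_itv.
      exact: measurable_realfun.open_measurable.
    move=> y /=; rewrite in_itv/= => ty; apply: tcU.
    by rewrite /ball/= ltr_distlC; lra.
  move=> /le_lt_trans/(_ muU); rewrite [ltLHS]mu_g_itv ?(ltW ttc)// lte_fin.
  by rewrite ltNge (jump_le g ttc).
have ft1 : 0 < rnorm (f t) by rewrite lt_neqAle rnorm_ge0 eq_sym rnorm_eq0 ft0.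
have near_neq0 s : rnorm (f s - f t) < rnorm (f t) -> f s != 0.
  by apply: contraTneq => ->; rewrite sub0r rnormN ltxx.
have [cl cr] := fc t tT Ct Dt.
have [[tpos lt]|[tltT rt]] := increasing_inside T_gt0 Ngm_0 T_notin tT Ct Dt.
  have /cvg_rnormP/(_ _ ft1)/lfilterP[d d0 dP] := cl lt.
  pose x := Num.max 0 (t - d / 2).
  have [x0 xt xd] : [/\ 0 <= x, x < t & t - d < x].
    by rewrite /x le_max lexx gt_max tpos lt_max; split => //; lra.
  have gxt : 0 < g t - g x by rewrite subr_gt0 lt.
  have [d' d'0 d'P] := derivator_left g t gxt.
  pose y := Num.max x (t - d' / 2).
  have [yt d'y] : y < t /\ t - d' < y.
    by rewrite /y gt_max xt lt_max; split; lra.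
  have gxy : g x < g y by have := d'P y d'y (ltW yt); lra.
  apply: (not_negligible_itv gxy); apply: negligibleS E0 => s /=.
  rewrite in_itv/= => /andP[xs sy]; have st := lt_trans sy yt.
  have s0 := le_trans x0 xs; have sT := lt_le_trans st t1.
  apply: memE; first by rewrite s0.
  by apply/near_neq0/dP; rewrite ?s0 ?(ltW sT) ?(lt_le_trans xd).
have /cvg_rnormP/(_ _ ft1)/rfilterP[d d0 dP] := cr rt.
pose y := Num.min T (t + d / 2).
have [yT ty yd] : [/\ y <= T, t < y & y < t + d].
  by rewrite /y ge_min lexx lt_min tltT gt_min; split => //; lra.
have gty : 0 < g y - g t by rewrite subr_gt0 rt.
have [d' d'0 d'P] := derivator_right g t gty.
pose x := Num.min y (t + d' / 2).
have [tx xd'] : t < x /\ x < t + d'.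
  by rewrite /x lt_min ty gt_min; split; lra.
have gxy : g x < g y by have := d'P x tx xd'; rewrite jump_eq0//; lra.
apply: (not_negligible_itv gxy); apply: negligibleS E0 => s /=.
rewrite in_itv/= => /andP[xs sy]; have ts := lt_le_trans tx xs.
have s0 := le_trans t0 (ltW ts); have sT := lt_le_trans sy yT.
apply: memE; first by rewrite s0.
by apply/near_neq0/dP; rewrite ?s0 ?(ltW sT) ?(lt_trans sy).
Qed.

End vanishing.

Theorem proposition5p3 (R : realType) (F : scalars) (g : derivator R) (T : R)
    (T_gt0 : 0 < T)
    (Ngm_0 : ~ Ngm g 0)
    (T_notin : ~ (Ngp g `|` Dg g `|` Cg g) T)
    (beta : R -> scalar_field R F)
    (beta_BD : BD g T beta)
    (beta_regressive : gregressive g T beta) :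
  exists v : R -> scalar_field R F,
    [/\ W11 g T v /\ BD1 g T v,
        solution g T beta v,
        forall u : R -> scalar_field R F, W11 g T u -> solution g T beta u ->
          forall t : R, 0 <= t <= T -> u t = v t
      & forall w : R -> scalar_field R F,
          (BD1 g T w /\ solution g T beta w) <->
          (exists h : R -> scalar_field R F,
             [/\ ker_gderive g T h, h 0 = 1
               & forall t : R, 0 <= t <= T -> w t = h t * v t])].
Proof.
pose gamma := adjoint g beta.
have gamma_BD : BD g T gamma by exact: BD_adjoint.
have [v [v0 vL v']] := exponential_exists T_gt0 beta_BD.
have [z [z0 zL z']] := exponential_exists T_gt0 gamma_BD.
have vBD := BD_lipschitz T_gt0 vL; have zBD := BD_lipschitz T_gt0 zL.
have star_C t : 0 <= t <= T -> ~ Cg g (star g t).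
  by move=> /andP[_ /(star_not_Cg T_notin)].
have mulz' u t : 0 <= t <= T -> ~ Cg g t -> rder g T u t (beta t * u t) ->
    rder g T (fun s => u s * z s) t 0.
  move=> tT Ct u'; have := rderM Ct u' (z' t tT Ct).
  rewrite /gamma /adjoint adjoint_cancel//.
  exact: regressive_neq0 beta_regressive tT.
have solE u : solution g T beta u -> exists2 E, (mu_g g).-negligible E &
    forall t, 0 <= t < T -> ~ E t ->
      gderivable g T u t /\ gderive g T u t = beta t * u t.
  move=> [uE _]; exists (~` [set t | 0 <= t < T ->
    gderivable g T u t /\ gderive g T u t - beta t * u t = 0]); first exact: uE.
  by move=> t tT /contrapT/(_ tT)[du /subr0_eq].
have mulz1 u : W11 g T u -> solution g T beta u ->
    forall t, 0 <= t <= T -> u t * z t = 1.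
  move=> uW us t tT; have [E E0 uE] := solE _ us.
  have := @W11_constant R F g T (fun s => u s * z s) E.
  rewrite us.2 z0 mulr1; apply => //; first exact: W11M (W11_lipschitz zL).
  move=> s sT Cs Es; have sT' : 0 <= s <= T by case/andP: sT => -> /ltW.
  apply: mulz' => //; have [du <-] := uE s sT Es.
  by rewrite -[X in rder _ _ _ X](star_id Cs); exact: gderive_rder.
have derive_exp h t : 0 <= t <= T -> (forall s, 0 <= s <= T -> ~ Cg g s ->
      rder g T h s (beta s * h s)) ->
    rder g T h (star g t) (beta (star g t) * h (star g t)).
  move=> tT h'; apply: h'; first exact: star_in.
  exact: star_C.
have BD1_exp h : BD g T h -> (forall t, 0 <= t <= T -> ~ Cg g t ->
    rder g T h t (beta t * h t)) ->
    BD1 g T h /\ (h 0 = 1 -> solution g T beta h).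
  move=> hBD h'; split.
    split=> [//|t tT|].
      exact: (rder_gderivable T_notin tT (derive_exp h t tT h')).
    apply: (@eq_BD _ _ _ _ T_gt0 ((fun t => beta t * h t) \o star g)).
      by move=> t tT; apply/esym/rder_gderiveE => //; exact: derive_exp.
    by apply: BD_star => //; exact: BDM.
  move=> h0; split=> //; apply: negligibleS (negligible_Cg g) => t /= nt.
  apply: contrapT => Ct; apply: nt => /andP[t0 tT].
  have tT' : 0 <= t <= T by rewrite t0 ltW.
  have := derive_exp h t tT' h'; rewrite star_id// => ht.
  have {}ht : rder g T h (star g t) (beta t * h t) by rewrite star_id.
  split; first exact: rder_gderivable ht.
  by rewrite (rder_gderiveE _ _ _ _ ht)// subrr.
have [vBD1 /(_ v0) vs] := BD1_exp v vBD v'.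
have vW := W11_lipschitz vL.
have vz1 := mulz1 v vW vs.
exists v; split=> //.
  move=> u uW us t tT.
  have zn0 : z t != 0.
    apply/eqP => zt; have := vz1 t tT; rewrite zt mulr0 => /esym/eqP.
    by rewrite oner_eq0.
  by apply: (mulIf zn0); rewrite vz1// mulz1.
move=> w; split=> [[[wBD dw dwBD] ws]|[h [[[hBD dh _] h'0] h0 wE]]].
  have [E E0 wE] := solE _ ws.
  have w' t : 0 <= t <= T -> ~ Cg g t -> rder g T w t (beta t * w t).
    move=> tT Ct.
    have <- : gderive g T w t = beta t * w t.
      apply/eqP; rewrite -subr_eq0; apply/eqP.
      apply: (@BD_ae_eq0 R F g T T_gt0 Ngm_0 T_notin
        (fun t => gderive g T w t - beta t * w t) E) => //.
        by apply: BDB => //; exact: BDM.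
      by move=> s sT Es; have [_ ->] := wE s sT Es; rewrite subrr.
    rewrite -[X in rder _ _ _ X](star_id Ct).
    by apply: gderive_rder => //; exact: dw.
  exists (fun t => w t * z t).
  have h' t : 0 <= t <= T -> rder g T (fun t => w t * z t) (star g t) 0.
    move=> tT; have Cst : ~ Cg g (star g t) by exact: star_C.
    by apply: mulz' => //; [exact: star_in|apply: w' => //; exact: star_in].
  have h'E t : 0 <= t <= T -> gderive g T (fun t => w t * z t) t = 0.
    by move=> tT; apply: rder_gderiveE => //; exact: h'.
  split.
  - split=> //; split; first exact: BDM.
      by move=> t tT; exact: (rder_gderivable T_notin tT (h' t tT)).
    apply: (@eq_BD _ _ _ _ T_gt0 (fun=> 0)); last exact: BD_cst.
    by move=> t tT; rewrite h'E.
  - by rewrite ws.2 z0 mulr1.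
  - by move=> t tT; rewrite -mulrA [z t * _]mulrC vz1// mulr1.
have w' t : 0 <= t <= T -> ~ Cg g t -> rder g T w t (beta t * w t).
  move=> tT Ct; have ht : rder g T h t 0.
    rewrite -(h'0 t tT) -[X in rder _ _ _ X](star_id Ct).
    by apply: gderive_rder => //; exact: dh.
  have := rderM Ct ht (v' t tT Ct).
  rewrite !mul0r add0r addr0 mulrCA -(wE t tT); apply: eq_rder => // s sT.
  by rewrite wE.
have wBD : BD g T w.
  apply: (@eq_BD _ _ _ _ T_gt0 (fun t => h t * v t)); last exact: BDM.
  by move=> t tT; rewrite wE.
have [wBD1 ws] := BD1_exp w wBD w'; split=> //; apply: ws.
by rewrite wE ?lexx ?ltW// h0 v0 mulr1.
Qed.
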